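(* Let $\Lambda\in\mathcal{L}$, $c\in C^0_\Lambda$, $f\in\mathbb{F}[\widetilde{\mathcal{O}}_{\Lambda,c}]$ and $\epsilon\in\{1,-1\}$. Write $w_0=w_0^c\,w_{0,c}$ with $w_0^c\in W^c$ and $w_{0,c}\in W_c$. Then $f$ is $\epsilon$-symmetric if and only if both of the following hold: 1. if $\epsilon=1$, $w_0\gamma^{qp}_{w_0^c}(f)$ is $J_c$-partially symmetric; if $\epsilon=-1$, $\iota w_0\gamma^{qp}_{w_0^c}(f)$ is $J_c$-partially anti-symmetric; 2. for all $w\in W^c$, $$\gamma^{qp}_w(f)=\begin{cases}t(w_{0,c})\,w_0\,\pi\big(T_{(w_0w)^{-1}}^{-1}\big)\,w_0\,\gamma^{qp}_{w_0^c}(f),&\epsilon=1,\\[2pt] t(w_{0,c})\,(-1)^{l(w_0)+l(w)}\,\iota w_0\,\pi(T_{w_0w})\,\iota w_0\,\gamma^{qp}_{w_0^c}(f),&\epsilon=-1.\end{cases}$$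
   Context: Let $E$ be a Euclidean space with dual $E^*$ and $\Phi\subset E^*$ a reduced irreducible root system (in its span). For $\alpha\in\Phi$, $\alpha^\vee\in E$ is the vector with $\langle y,\alpha^\vee\rangle=2\alpha(y)/\|\alpha\|^2$ for all $y\in E$. Fix simple roots $\alpha_1,\dots,\alpha_r$ and positive roots $\Phi^+$; $W$ is the finite Weyl group, with simple reflections $s_i$, acting on $E$ by $s_\alpha(y)=y-\alpha(y)\alpha^\vee$; $l$ is the length, $w_0$ the longest element. $Q^\vee$ is the coroot lattice. $\mathcal{L}$ is the set of finitely generated abelian subgroups $\Lambda\subset E$ with $Q^\vee\subseteq\Lambda$ and $\alpha(\Lambda)\subseteq\mathbb{Z}$ for all $\alpha\in\Phi$. $\mathbb{F}$ is a field; $\mathbb{F}[E]$ is the group algebra with basis $x^y$ ($y\in E$), and $\mathbb{F}[S]$ is the span of $x^y$, $y\in S$; $W$ acts by $wx^y=x^{wy}$; $\iota$ is the linear map $x^y\mapsto x^{-y}$. $\widetilde W_\Lambda=W\ltimes\Lambda$ acts on $E$ with $\Lambda$ acting by translations. $\overline{C^+}=\{y\in E:0\le\alpha(y)\le1\ \forall\alpha\in\Phi^+\}$. $C^0_\Lambda$ is the set of $c\in\overline{C^+}$ whose stabilizer in $\widetilde W_\Lambda$ equals its stabilizer $W_c$ in $W$. $J_c=\{j:s_jc=c\}$, $W_c=\langle s_j:j\in J_c\rangle$; $W^c$ is the set of minimal length representatives of $W/W_c$. $\widetilde{\mathcal{O}}_{\Lambda,c}=\{\lambda+wc:\lambda\in\Lambda,w\in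 W\}$. For $c\in C^0_\Lambda$, $\mathbb{F}[\widetilde{\mathcal{O}}_{\Lambda,c}]$ is a free $\mathbb{F}[\Lambda]$-module with basis $x^{wc}$ ($w\in W^c$), and $\gamma^{qp}_w$ is defined by $f=\sum_{w\in W^c}\gamma_w^{qp}(f)x^{wc}$. Fix a $W$-invariant map $\Phi\to\mathbb{F}^\times$, $\alpha\mapsto t_\alpha$; $t_j=t_{\alpha_j}$, and $t(w)=t_{j_1}\cdots t_{j_k}$ for a reduced expression $w=s_{j_1}\cdots s_{j_k}$. For $f\in\mathbb{F}[\Lambda]$, $\nabla_j(f)=\frac{s_jf-f}{x^{\alpha_j^\vee}-1}$. The extended affine Hecke algebra $\widetilde{\mathcal{H}}_\Lambda$ is generated by $T_1,\dots,T_r$ and $x^\lambda$ ($\lambda\in\Lambda$) with: braid relations; $(T_j-t_j)(T_j+t_j^{-1})=0$; $x^\lambda x^\mu=x^{\lambda+\mu}$, $x^0=1$; $T_jx^\lambda-x^{s_j\lambda}T_j=(t_j-t_j^{-1})\nabla_j(x^\lambda)$. $T_w=T_{j_1}\cdots T_{j_k}$ for a reduced expression. Polynomial representation $\pi$ on $\mathbb{F}[\Lambda]$: $\pi(T_j)f=t_js_jf+(t_j-t_j^{-1})\nabla_j(f)$, $\pi(x^\mu)$ multiplication by $x^\mu$. Quasi-polynomial representation $\pi^{qp}$ on $\mathbb{F}[E]$ (preserving $\mathbb{F}[\widetilde{\mathcal{O}}_{\Lambda,c}]$): $\pi^{qp}(x^\lambda)x^y=x^{\lambda+y}$ and $\pi^{qp}(T_j)x^y=\chi_j(\alpha_j(y))x^{s_jy}+(t_j-t_j^{-1})\frac{x^{y-\lfloor\alpha_j(y)\rfloor\alpha_j^\vee}-x^y}{x^{\alpha_j^\vee}-1}$,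 where $\chi_j(a)=t_j$ if $a\in\mathbb{Z}$ and $\chi_j(a)=1$ otherwise. $f\in\mathbb{F}[E]$ is $\epsilon$-symmetric if $\pi^{qp}(T_i)f=\epsilon t_i^{\epsilon}f$ for all $1\le i\le r$. $p\in\mathbb{F}[\Lambda]$ is $J$-partially symmetric (resp. anti-symmetric) if $\pi(T_j)p=t_jp$ (resp. $\pi(T_j)p=-t_j^{-1}p$) for all $j\in J$. *)

(* Defs.v *)
From HB Require Import structures.
From mathcomp Require Import all_boot all_order all_algebra.
From mathcomp Require Import finmap multinomials.monalg.
From mathcomp Require Import boolp classical_sets fsbigop reals.

Set Implicit Arguments.
Unset Strict Implicit.
Unset Printing Implicit Defensive.

Import Order.TTheory GRing.Theory Num.Theory.
Local Open Scope classical_set_scope.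
Local Open Scope ring_scope.

Notation dual E := 'Hom(E, (GRing.regular _)).

Section Euclidean.
Variables (R : realType) (E : vectType R) (ip : {dot E for @idfun R}).
Implicit Types a b : dual E.

(* The vector representing [a] through the inner product: E^* is identified
   with E by Riesz, and carries the transported inner product. *)
Definition riesz a : E := xget 0 [set v | forall y, ip y v = a y].
Definition dual_ip a b : R := ip (riesz a) (riesz b).

Definition coroot a : E := (2 / dual_ip a a) *: riesz a.

Definition reflection a : 'End(E) := linfun (fun y => y - a y *: coroot a).

Definition nat_comb r (simple : 'I_r -> dual E) a : Prop :=
  exists n : 'I_r -> nat, a = \sum_(i < r) simple i *+ n i.

(* A reduced irreducible root system in the span of [root_seq], together with a
   choice of simple roots. *)
Record based_root_system := BasedRootSystem {
  root_seq : seq (dual E);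
  rs_rank : nat;
  simple : 'I_rs_rank -> dual E;
  roots_neq0 : 0 \notin root_seq;
  roots_refl : forall a b, a \in root_seq -> b \in root_seq ->
    b - b (coroot a) *: a \in root_seq;
  roots_int : forall a b, a \in root_seq -> b \in root_seq ->
    (b (coroot a) : R) \is a Num.int;
  roots_reduced : forall a (k : R), a \in root_seq -> k *: a \in root_seq ->
    k = 1 \/ k = -1;
  roots_nonempty : exists a, a \in root_seq;
  roots_irreducible : forall P : pred (dual E),
    (exists2 a, a \in root_seq & P a) -> (exists2 b, b \in root_seq & ~~ P b) ->
    exists a b, [/\ a \in root_seq, b \in root_seq, P a, ~~ P b & dual_ip a b != 0];
  simple_roots : forall i, simple i \in root_seq;
  simple_free : free [seq simple i | i <- enum 'I_rs_rank];
  simple_base : forall a, a \in root_seq ->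
    nat_comb simple a \/ nat_comb simple (- a)
}.

End Euclidean.

Section GroupAlgebra.
Variables (R : realType) (E : vectType R) (F : fieldType).
(* The group algebra F[E] is the space of finitely supported functions E -> F,
   with x^y represented by << y >>. *)
Implicit Types (f g h : {malg F[E]}) (y : E).

Definition lin_ext (V : lmodType F) (phi : E -> V) f : V :=
  \sum_(y <- msupp f) f@_y *: phi y.

(* [monalg] only provides products over monoids without inverses. *)
Definition gmul f g : {malg F[E]} :=
  lin_ext (fun y => lin_ext (fun z => << y + z >> : {malg F[E]}) g) f.

(* h / (x^v - 1), which is unique when v != 0 *)
Definition gdiv h (v : E) : {malg F[E]} :=
  xget 0 [set g | gmul (<< v >> - << 0 >>) g = h].

Definition gspan (S : set E) : set {malg F[E]} :=
  [set f | forall y, y \in msupp f -> S y].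

Definition wact (w : 'End(E)) : {malg F[E]} -> {malg F[E]} :=
  lin_ext (fun y => << w y >>).

(* the linear map x^y |-> x^(-y), usually written iota *)
Definition xinv : {malg F[E]} -> {malg F[E]} := lin_ext (fun y => << - y >>).

End GroupAlgebra.

Section Weyl.
Variables (R : realType) (E : vectType R) (ip : {dot E for @idfun R}).
Variable Phi : based_root_system ip.
Implicit Types (w : 'End(E)) (s : seq 'I_(rs_rank Phi)) (L : set E) (c : E).

Definition pos_root (a : dual E) : Prop :=
  a \in root_seq Phi /\ nat_comb (@simple _ _ _ Phi) a.

Definition simple_refl (i : 'I_(rs_rank Phi)) : 'End(E) := reflection ip (simple i).
Definition simple_coroot (i : 'I_(rs_rank Phi)) : E := coroot ip (simple i).

Definition weyl : set 'End(E) :=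
  [set w | exists2 u : seq (dual E), {subset u <= root_seq Phi} &
     w = foldr (fun a v => (reflection ip a \o v)%VF) \1%VF u].

Definition word_prod s : 'End(E) :=
  foldr (fun i v => (simple_refl i \o v)%VF) \1%VF s.

Definition reduced_expr w s : Prop :=
  word_prod s = w /\ forall s', word_prod s' = w -> (size s <= size s')%N.

(* A chosen reduced expression; t(w) and T_w below do not depend on the choice,
   by Matsumoto's theorem. *)
Definition redex w : seq 'I_(rs_rank Phi) := xget [::] [set s | reduced_expr w s].

Definition len w : nat := size (redex w).

Definition longest w : Prop :=
  weyl w /\ forall v, weyl v -> (len v <= len w)%N.

Definition coroot_lattice : set E :=
  [set y | inIntSpan (in_tuple [seq coroot ip a | a <- root_seq Phi]) y].

Definition admissible_lattice L : Prop :=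
  [/\ exists m (s : m.-tuple E), L = [set y | inIntSpan s y],
      coroot_lattice `<=` L
    & forall a y, a \in root_seq Phi -> L y -> (a y : R) \is a Num.int].

Definition closed_alcove : set E :=
  [set y | forall a, pos_root a -> 0 <= (a y : R) <= 1].

Definition weyl_stab c : set 'End(E) := [set w | weyl w /\ w c = c].

(* Elements of W |x L are pairs (l, w), acting by y |-> l + w y. *)
Definition ext_stab L c : set (E * 'End(E)) :=
  [set u | [/\ L u.1, weyl u.2 & u.1 + u.2 c = c]].

Definition C0 L : set E :=
  [set c | closed_alcove c /\
     ext_stab L c = [set u | u.1 = 0 /\ weyl_stab c u.2]].

Definition Jset c : set 'I_(rs_rank Phi) := [set j | simple_refl j c = c].

Definition min_reps c : set 'End(E) :=
  [set w | weyl w /\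
     forall v, weyl_stab c v -> (len w <= len (w \o v)%VF)%N].

Definition ext_orbit L c : set E :=
  [set y | exists l w, [/\ L l, weyl w & y = l + w c]].

(* the order of s_i s_j *)
Definition cox_order (i j : 'I_(rs_rank Phi)) (m : nat) : Prop :=
  let pw k := iter k (fun v => (simple_refl i \o simple_refl j \o v)%VF) \1%VF in
  [/\ (0 < m)%N, pw m = \1%VF
    & forall k, (0 < k < m)%N -> pw k <> \1%VF].

End Weyl.

Section Hecke.
Variables (R : realType) (E : vectType R) (ip : {dot E for @idfun R}).
Variables (Phi : based_root_system ip) (F : fieldType).
Variable t : dual E -> F.
Implicit Types (i j : 'I_(rs_rank Phi)) (w : 'End(E)) (f p : {malg F[E]}).
Implicit Types (L : set E) (c : E).

(* W acts on E^* by (w a)(y) = a (w^-1 y). *)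
Definition weyl_invariant : Prop :=
  forall a w, a \in root_seq Phi -> weyl Phi w -> t (a \o w^-1)%VF = t a.

Definition tj j : F := t (simple j).
Definition tw w : F := \prod_(j <- redex Phi w) tj j.

Definition nabla j f : {malg F[E]} :=
  gdiv (wact (simple_refl j) f - f) (simple_coroot j).

Definition alt_prod (A : algType F) (x y : A) (m : nat) : A :=
  \prod_(k < m) (if odd k then y else x).

(* The generators x^l are only meaningful for l in L. *)
Definition hecke_relations L (A : algType F)
    (T : 'I_(rs_rank Phi) -> A) (X : E -> A) : Prop :=
  [/\ forall i j m, i != j -> cox_order i j m ->
        alt_prod (T i) (T j) m = alt_prod (T j) (T i) m,
      forall j, (T j - (tj j)%:A) * (T j + ((tj j)^-1)%:A) = 0,
      forall l m, L l -> L m -> X l * X m = X (l + m),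
      X 0 = 1
    & forall j l, L l ->
        T j * X l - X (simple_refl j l) * T j
        = (tj j - (tj j)^-1) *: lin_ext X (nabla j << l >>)].

(* H is presented by the generators T_j, x^l and the above relations, i.e. it is
   initial among the algebras satisfying them. *)
Definition is_affine_hecke L (H : algType F)
    (T : 'I_(rs_rank Phi) -> H) (X : E -> H) : Prop :=
  hecke_relations L T X /\
  forall (A : algType F) (T' : 'I_(rs_rank Phi) -> A) (X' : E -> A),
    hecke_relations L T' X' ->
    let extends (phi : {lrmorphism H -> A}) :=
      (forall j, phi (T j) = T' j) /\ (forall l, L l -> phi (X l) = X' l) in
    (exists phi, extends phi) /\
    (forall phi psi, extends phi -> extends psi -> phi =1 psi).

Definition Tw (H : algType F) (T : 'I_(rs_rank Phi) -> H) w : H :=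
  \prod_(j <- redex Phi w) T j.

(* [pi] makes the subspace M of F[E] an H-module; its values outside M are
   irrelevant. *)
Definition is_representation (H : algType F) (M : set {malg F[E]})
    (pi : H -> {malg F[E]} -> {malg F[E]}) : Prop :=
  [/\ forall h f, M f -> M (pi h f),
      forall h k f g, M f -> M g -> pi h (k *: f + g) = k *: pi h f + pi h g,
      forall h h' k f, M f -> pi (k *: h + h') f = k *: pi h f + pi h' f,
      forall h h' f, M f -> pi (h * h') f = pi h (pi h' f)
    & forall f, M f -> pi 1 f = f].

Definition is_poly_rep L (H : algType F) (T : 'I_(rs_rank Phi) -> H) (X : E -> H)
    (pi : H -> {malg F[E]} -> {malg F[E]}) : Prop :=
  [/\ is_representation (gspan L) pi,
      forall j f, gspan L f ->
        pi (T j) f = tj j *: wact (simple_refl j) f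
                     + (tj j - (tj j)^-1) *: nabla j f
    & forall m f, L m -> gspan L f -> pi (X m) f = gmul << m >> f].

Definition chi j (a : R) : F := if a \is a Num.int then tj j else 1.

(* the operator pi^qp(T_j) on F[E], extended linearly from the x^y *)
Definition qpT j : {malg F[E]} -> {malg F[E]} :=
  lin_ext (fun y =>
    chi j (simple j y) *: << simple_refl j y >>
    + (tj j - (tj j)^-1) *:
      gdiv (<< y - simple_coroot j *~ Num.floor (simple j y : R) >> - << y >>)
           (simple_coroot j)).

Definition eps_symmetric (eps : int) f : Prop :=
  forall j, qpT j f = (eps%:~R * tj j ^ eps) *: f.

(* gamma^qp_w(f), as a function of w; it is only determined on [min_reps] *)
Definition gamma_qp L c f : 'End(E) -> {malg F[E]} :=
  xget (fun=> 0) [set g : 'End(E) -> {malg F[E]} |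
    (forall w, min_reps Phi c w -> gspan L (g w)) /\
    f = \sum_(w \in min_reps Phi c) gmul (g w) << w c >>].

Definition part_symmetric L (H : algType F) (T : 'I_(rs_rank Phi) -> H)
    (pi : H -> {malg F[E]} -> {malg F[E]}) (J : set 'I_(rs_rank Phi)) p : Prop :=
  gspan L p /\ forall j, J j -> pi (T j) p = tj j *: p.

Definition part_antisymmetric L (H : algType F) (T : 'I_(rs_rank Phi) -> H)
    (pi : H -> {malg F[E]} -> {malg F[E]}) (J : set 'I_(rs_rank Phi)) p : Prop :=
  gspan L p /\ forall j, J j -> pi (T j) p = - (tj j)^-1 *: p.

End Hecke.

(* Main.v *)
(** Write f as the sum of the gamma_u x^(u c) over u in W^c.  On the coset of
    u c, pi^qp(T_j) acts as pi(T_j) if s_j fixes u c, and otherwise it couples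
    the cosets of u and of s_j u, which is again in W^c.  Since
    s_j nabla_j = nabla_j + s_j - 1, f is eps-symmetric iff for all u and j
    - A_j gamma_u = t_j^-1 gamma_u when s_j u c = u c,
    - gamma_u = A_j gamma_(s_j u) when s_j u c <> u c and s_j u > u,
    where A_j = theta pi(b_k) theta with alpha_k = - w_0 alpha_j, and
    (b, theta) is (T^-1, w_0) for eps = 1 and (- T, iota w_0) for eps = -1.

    Every u in W^c other than w_0^c has such an ascent s_j u in W^c, so the
    second condition expresses gamma_u through gamma_(w_0^c), and the factors b_k
    multiply up to b_(w_0 u) by Matsumoto's theorem.  In the first condition
    s_j u = u s_i with i in J_c; hence b_(w_0 u) = b_k b_(w_0 s_j u)
    = b_(w_0 s_j u) b_i, and what remains is an eigenvector condition for the
    b_i, i in J_c, on theta gamma_(w_0^c). *)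

Require Import Defs.
From HB Require Import structures.
From mathcomp Require Import all_boot all_order all_algebra.
From mathcomp Require Import finmap multinomials.monalg.
From mathcomp Require Import boolp classical_sets fsbigop reals.
From mathcomp Require Import cardinality.
From mathcomp Require Import ring lra zify.

Set Implicit Arguments.
Unset Strict Implicit.
Unset Printing Implicit Defensive.

Import Order.TTheory GRing.Theory Num.Theory.
Local Open Scope classical_set_scope.
Local Open Scope ring_scope.

(** * Coroots in a Euclidean space *)

Section Euclid.
Variables (R : realType) (E : vectType R) (ip : {dot E for @idfun R}).
Implicit Types (a b : dual E) (x y z : E).

(** The assumption on c enters twice. It excludes alpha(c) = 1 for positive alpha, so that
    |alpha_j(u c)| < 1 and the floors in pi^qp(T_j) drop below the integral part coming from Lambda
    by at most one. It also makes the cosets of the points u c disjoint, so that f may be compared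
    component by component. For a pair u, s_j u with s_j u > u, eps-symmetry gives two equations,
    one at each end. The one at s_j u, solved for the other component, is the coupling gamma_u = A_j
    gamma_(s_j u). The one at u then follows from the quadratic relation kappa (kappa - (t_j -
    t_j^-1)) = 1 for kappa = eps t_j^eps. This is why only ascents appear in the second condition.
    When s_j fixes u c and eps = 1, pi(T_j) and A_j are different operators. Their eigenvector
    equations agree because each of them forces nabla_j gamma_u = 0. *)

Lemma ipC x y : ip x y = ip y x.
Proof. by rewrite hermitian_subproof expr0 mul1r. Qed.

Lemma ip_linr x k y z : ip x (k *: y + z) = k * ip x y + ip x z.
Proof. by rewrite linearP. Qed.

Lemma ip_linl x k y z : ip (k *: y + z) x = k * ip y x + ip z x.
Proof. by rewrite ipC ip_linr !(ipC x). Qed.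

Lemma ip_gt0 x : x != 0 -> 0 < ip x x.
Proof. exact: neq0_dnorm_gt0. Qed.

Lemma ip0l x : ip 0 x = 0.
Proof. by have := ip_linl x (-1) 0 0; rewrite scaler0 addr0 mulN1r addNr. Qed.

Lemma ip_eq0 x : (forall y, ip y x = 0) -> x = 0.
Proof.
by move=> h; apply/eqP/negPn/negP => /ip_gt0; rewrite h ltxx.
Qed.

Lemma ip_injr x y : (forall z, ip z x = ip z y) -> x = y.
Proof.
move=> h; apply/subr0_eq/ip_eq0 => z.
by rewrite addrC -scaleN1r ip_linr h mulN1r addNr.
Qed.

(** Maps such as [reflection] apply [linfun] to a bare function. Its values can be computed once the
    function carries a linear structure, and packing one leaves [linfun phi] unchanged up to
    conversion. *)
Lemma mk_linfun (V W : vectType R) (phi : V -> W) :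
  linear phi -> exists f : 'Hom(V, W), linfun phi = f /\ forall x : V, f x = phi x.
Proof.
move=> lin; pose M := GRing.isLinear.Build _ _ _ _ phi lin.
pose phi' : {linear V -> W} := HB.pack phi M.
by exists (linfun phi); split => // x; exact: (lfunE phi').
Qed.

Lemma linfunE_lin (V W : vectType R) (phi : V -> W) (x : V) :
  linear phi -> linfun phi x = phi x.
Proof. by move=> /mk_linfun[f [-> ->]]. Qed.

(** The map sending v to the functional [ip _ v] is injective, and E and its dual have the same
    dimension. *)
Lemma riesz_ex a : exists v, forall y, ip y v = a y.
Proof.
pose phi (v : E) : dual E := linfun (fun y => ip y v : R^o).
have phiE v y : phi v y = ip y v.
  by rewrite /phi linfunE_lin // => k y1 y2; rewrite ip_linl.
have lin : linear phi.
  move=> k v1 v2; apply/lfunP => y; rewrite !phiE.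
  by rewrite ip_linr add_lfunE scale_lfunE !phiE.
have [f [_ fE]] := mk_linfun lin.
have kf : lker f == 0%VS.
  apply/lker0P => v w; rewrite !fE => e; apply: ip_injr => z.
  by rewrite -!phiE e.
have /eqP full : (limg f == fullv)%VS.
  rewrite eqEdim subvf /= limg_dim_eq ?capfv ?(eqP kf) //.
  by rewrite !dimvf /= /dim /= muln1.
have /memv_imgP[v _ ->] : (a \in limg f) by rewrite full memvf.
by exists v => y; rewrite fE phiE.
Qed.

Lemma rieszP a y : ip y (riesz ip a) = a y.
Proof.
rewrite /riesz; case: xgetP => [v _ /= //|] h.
by have [v hv] := riesz_ex a; case: (h v).
Qed.

Lemma riesz_uniq a v : (forall y, ip y v = a y) -> riesz ip a = v.
Proof. by move=> h; apply: ip_injr => z; rewrite rieszP h. Qed.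

Lemma riesz_lin k a b : riesz ip (k *: a + b) = k *: riesz ip a + riesz ip b.
Proof. by apply: riesz_uniq => y; rewrite ip_linr !rieszP !lfunE /= lfunE. Qed.

Lemma riesz0 : riesz ip 0 = 0.
Proof. by apply: riesz_uniq => y; rewrite ipC ip0l lfunE. Qed.

Lemma rieszN a : riesz ip (- a) = - riesz ip a.
Proof. by have := riesz_lin (-1) a 0; rewrite riesz0 !addr0 !scaleN1r. Qed.

Lemma riesz_neq0 a : a != 0 -> riesz ip a != 0.
Proof.
apply: contra_neq => h; apply/lfunP => y.
by rewrite -rieszP h ipC ip0l lfunE.
Qed.

Lemma dual_ipE a b : dual_ip ip a b = b (riesz ip a).
Proof. by rewrite /dual_ip rieszP. Qed.

Lemma dual_ip_gt0 a : a != 0 -> 0 < dual_ip ip a a.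
Proof. by move=> /riesz_neq0/ip_gt0. Qed.

Lemma coroot_self a : a != 0 -> a (coroot ip a) = 2.
Proof.
move=> a0; rewrite /coroot linearZ /= -dual_ipE.
by apply: divfK; rewrite lt0r_neq0 // dual_ip_gt0.
Qed.

Lemma corootN a : coroot ip (- a) = - coroot ip a.
Proof.
rewrite /coroot; have -> : dual_ip ip (- a) (- a) = dual_ip ip a a.
  by rewrite !dual_ipE rieszN opp_lfunE [a (- _)]linearN opprK.
by rewrite rieszN scalerN.
Qed.

Lemma reflectionE a y : reflection ip a y = y - a y *: coroot ip a.
Proof.
rewrite linfunE_lin // => k u v.
rewrite linearP /= -[k *: a u]/(k * a u) scalerDl -scalerA opprD.
by rewrite scalerBr addrACA.
Qed.

Lemma reflectionN a : reflection ip (- a) = reflection ip a.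
Proof.
by apply/lfunP => y; rewrite !reflectionE corootN opp_lfunE scaleNr scalerN opprK.
Qed.

Lemma reflection_invol a : a != 0 -> (reflection ip a \o reflection ip a = \1)%VF.
Proof.
move=> a0; apply/lfunP => y; rewrite comp_lfunE !reflectionE lfunE /=.
have -> : a (y - a y *: coroot ip a) = - a y.
  have e : a (a y *: coroot ip a) = a y * 2.
    by rewrite linearZ /= coroot_self.
  by rewrite linearB /= e; ring.
by rewrite scaleNr opprK subrK.
Qed.
End Euclid.

Lemma lfun_inv_uniq (R : realType) (E : vectType R) (v w : 'End(E)) :
  (v \o w = \1)%VF -> (w \o v = \1)%VF -> (w^-1)%VF = v.
Proof.
move=> vw wv; have kw : lker w == 0%VS.
  apply/lker0P => x y e.
  by rewrite -[x]id_lfunE -[y]id_lfunE -vw !comp_lfunE e.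
by rewrite -[RHS]comp_lfun1l -(lker0_compVf kw) -comp_lfunA wv comp_lfun1r.
Qed.

(** * Positive roots and the exchange condition *)

Section Roots.
Variables (R : realType) (E : vectType R) (ip : {dot E for @idfun R}).
Variable Phi : based_root_system ip.
Implicit Types (a b : dual E) (w v u : 'End(E)) (s : seq 'I_(rs_rank Phi)).
Implicit Types (i j k : 'I_(rs_rank Phi)) (y c : E).
Local Notation al := (@simple _ _ _ Phi).
Local Notation rt := (root_seq Phi).
Local Notation pos := (pos_root Phi).
Local Notation sr := (@simple_refl _ _ _ Phi).
Local Notation wp := (@word_prod _ _ _ Phi).

Lemma root_neq0 a : a \in rt -> a != 0.
Proof. by move=> ar; apply: contraTneq ar => ->; exact: roots_neq0. Qed.

Lemma simple_neq0 i : al i != 0.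
Proof. exact/root_neq0/simple_roots. Qed.

Lemma comp_reflection a b :
  (b \o reflection ip a)%VF = b - b (coroot ip a) *: a.
Proof.
apply/lfunP => y; rewrite comp_lfunE reflectionE add_lfunE opp_lfunE scale_lfunE.
rewrite linearB; congr (_ - _).
by rewrite [LHS]linearZ /=; exact: mulrC.
Qed.

Lemma root_refl a b : a \in rt -> b \in rt -> (b \o reflection ip a)%VF \in rt.
Proof. by move=> ar br; rewrite comp_reflection; exact: roots_refl. Qed.

Lemma comp_reflection_self a : a != 0 -> (a \o reflection ip a)%VF = - a.
Proof.
move=> a0; rewrite comp_reflection coroot_self //.
by rewrite scaler_nat mulr2n opprD addNKr.
Qed.

Lemma root_opp a : a \in rt -> - a \in rt.
Proof.
by move=> ar; rewrite -comp_reflection_self ?root_neq0 //; exact: root_refl.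
Qed.

Lemma simple_indep (k : 'I_(rs_rank Phi) -> R) :
  \sum_i k i *: al i = 0 -> forall i, k i = 0.
Proof.
move=> e i0; have sz : size [seq al i | i <- enum 'I_(rs_rank Phi)] == rs_rank Phi.
  by rewrite size_map size_enum_ord.
have /freeP h : free (Tuple sz) by exact: simple_free.
apply: h; rewrite -[RHS]e; apply: eq_bigr => i _; congr (_ *: _).
by rewrite (nth_map i) ?size_enum_ord // nth_ord_enum.
Qed.

Lemma simple_coordP (p q : 'I_(rs_rank Phi) -> R) :
  \sum_i p i *: al i = \sum_i q i *: al i -> p =1 q.
Proof.
move=> e i; apply/subr0_eq; apply: (@simple_indep (fun i => p i - q i)).
by under eq_bigr do rewrite scalerBl; rewrite sumrB e subrr.
Qed.

Lemma nat_combP a :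
  nat_comb al a <-> exists n : 'I_(rs_rank Phi) -> nat, a = \sum_i (n i)%:R *: al i.
Proof.
split=> -[n ->]; exists n; apply: eq_bigr => i _; by rewrite scaler_nat.
Qed.

Lemma root_pos_or_neg a : a \in rt -> pos a \/ pos (- a).
Proof.
by move=> ar; case: (simple_base ar); [left|right]; split => //; exact: root_opp.
Qed.

Lemma pos_neg_false a : pos a -> ~ pos (- a).
Proof.
move=> [ar /nat_combP[n en]] [_ /nat_combP[m em]].
have nm i : (n i)%:R + (m i)%:R = 0 :> R.
  move: i; apply: simple_indep.
  by under eq_bigr do rewrite scalerDl; rewrite big_split /= -en -em subrr.
have n0 i : n i = 0%N by move: (nm i) => /eqP; rewrite -natrD pnatr_eq0 addn_eq0 => /andP[/eqP].
by move/root_neq0/eqP: ar; apply; rewrite en big1 // => i _; rewrite n0 scale0r.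
Qed.

Lemma simple_pos i : pos (al i).
Proof.
split; first exact: simple_roots.
exists (fun j => (j == i) : nat); rewrite (bigD1 i) //= eqxx mulr1n big1 ?addr0 //.
by move=> j /negPf ->.
Qed.

(** s_i changes only the coefficient of alpha_i. If the image were negative, all other coefficients
    of a would vanish, and reducedness would leave only a = alpha_i. *)
Lemma pos_simple_reflection i a : pos a -> a != al i -> pos (a \o sr i)%VF.
Proof.
move=> [ar an] ai; have r2 : (a \o sr i)%VF \in rt by exact/root_refl/ar/simple_roots.
case: (root_pos_or_neg r2) => // -[_ /nat_combP[m em]].
have /nat_combP[n en] := an.
pose k : R := a (coroot ip (al i)).
have c j : j != i -> n j = 0%N.
  have E1 : \sum_j (n j + m j)%:R *: al j = \sum_j (k *+ (j == i)) *: al j.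
    under eq_bigr do rewrite natrD scalerDl.
    rewrite big_split /= -en -em comp_reflection opprB addrC subrK.
    rewrite (bigD1 i) //= eqxx mulr1n big1 ?addr0 // => j' /negPf ->.
    by rewrite mulr0n scale0r.
  move=> /negPf ji; have /eqP := simple_coordP E1 j.
  by rewrite ji mulr0n pnatr_eq0 addn_eq0 => /andP[/eqP].
have ea : a = (n i)%:R *: al i.
  rewrite en (bigD1 i) //= big1 ?addr0 // => j ji.
  by rewrite c // scale0r.
have [|h|h] := @roots_reduced _ _ _ Phi (al i) (n i)%:R (simple_roots i).
- by rewrite -ea.
- by move/eqP: ai; rewrite ea h scale1r.
- by have := ler0n R (n i); rewrite h ler0N1.
Qed.

Lemma reflection_adj b y z : b != 0 ->
  ip (reflection ip b y) z = ip y (reflection ip b z).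
Proof.
move=> b0; rewrite !reflectionE !(addrC _ (- _)) -!scaleNr.
rewrite ip_linl ip_linr /coroot.
have h x : ip x ((2 / dual_ip ip b b) *: riesz ip b) = 2 / dual_ip ip b b * b x.
  by rewrite -[_ *: _]addr0 ip_linr rieszP [ip x 0]ipC ip0l addr0.
by rewrite [ip (_ *: _) z]ipC !h; ring.
Qed.

Lemma coroot_comp a b : b != 0 ->
  coroot ip (a \o reflection ip b)%VF = reflection ip b (coroot ip a).
Proof.
move=> b0; have r : riesz ip (a \o reflection ip b)%VF = reflection ip b (riesz ip a).
  by apply: riesz_uniq => y; rewrite -reflection_adj // rieszP comp_lfunE.
rewrite /coroot !dual_ipE r comp_lfunE -[reflection ip b (reflection _ _ _)]comp_lfunE.
by rewrite reflection_invol // id_lfunE linearZ.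
Qed.

Lemma reflection_comp a b : b != 0 ->
  (reflection ip b \o reflection ip (a \o reflection ip b)%VF)%VF
  = (reflection ip a \o reflection ip b)%VF.
Proof.
move=> b0; apply/lfunP => y; rewrite !comp_lfunE !(reflectionE _ (a \o _)%VF).
rewrite coroot_comp // linearB linearZ /=.
rewrite -[reflection ip b (reflection _ _ (coroot _ _))]comp_lfunE.
by rewrite reflection_invol // id_lfunE comp_lfunE [in RHS]reflectionE.
Qed.

Lemma sr_invol i : (sr i \o sr i = \1)%VF.
Proof. exact/reflection_invol/simple_neq0. Qed.

Lemma sr_involK i w : (sr i \o (sr i \o w) = w)%VF.
Proof. by rewrite comp_lfunA sr_invol comp_lfun1l. Qed.

Lemma sr_Kinvol i w : ((w \o sr i) \o sr i = w)%VF.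
Proof. by rewrite -comp_lfunA sr_invol comp_lfun1r. Qed.

Lemma sr_neq1 i : sr i <> \1%VF.
Proof.
move=> h; have := comp_reflection_self (simple_neq0 i).
rewrite -/(simple_refl i) h comp_lfun1r => /esym e.
by apply: (@pos_neg_false (al i)); rewrite ?e; exact: simple_pos.
Qed.

Lemma wp_cons i s : wp (i :: s) = (sr i \o wp s)%VF.
Proof. by []. Qed.

Lemma wp_cat s1 s2 : wp (s1 ++ s2) = (wp s1 \o wp s2)%VF.
Proof.
by elim: s1 => [|i s1 IH]; rewrite ?comp_lfun1l // cat_cons !wp_cons IH comp_lfunA.
Qed.

Lemma wp1 i : wp [:: i] = sr i.
Proof. by rewrite wp_cons comp_lfun1r. Qed.

Lemma wp_rcons s i : wp (rcons s i) = (wp s \o sr i)%VF.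
Proof. by rewrite -cats1 wp_cat wp1. Qed.

Lemma wp_revl s : (wp (rev s) \o wp s = \1)%VF.
Proof.
elim: s => [|i s IH]; first by rewrite comp_lfun1l.
by rewrite rev_cons wp_rcons wp_cons -comp_lfunA sr_involK IH.
Qed.

Lemma wp_revr s : (wp s \o wp (rev s) = \1)%VF.
Proof. by have := wp_revl (rev s); rewrite revK. Qed.

Lemma wp_inv s : (wp s)^-1%VF = wp (rev s).
Proof. by apply: lfun_inv_uniq; [exact: wp_revl|exact: wp_revr]. Qed.

Lemma root_wp a s : a \in rt -> (a \o wp s)%VF \in rt.
Proof.
elim: s a => [|i s IH] a ar; first by rewrite comp_lfun1r.
by rewrite wp_cons comp_lfunA; apply/IH/root_refl => //; exact: simple_roots.
Qed.

(* Roots are acted on from the right: [(a \o w)%VF] is w^-1 a, so that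
   l(s_i w) > l(w) iff [(simple i \o w)%VF] is positive. *)
Lemma strong_exchange a s : pos a -> pos (- (a \o wp s))%VF ->
  exists2 s', wp s' = (reflection ip a \o wp s)%VF & (size s').+1 = size s.
Proof.
elim: s a => [|i s IH] a pa.
  by rewrite comp_lfun1r => /(pos_neg_false pa).
(* The letter to drop is the one that meets the root when it has become that letter's own simple
   root: only there can a positive root turn negative. *)
rewrite wp_cons comp_lfunA; have [->|ai] := eqVneq a (al i).
  by move=> _; exists s => //; rewrite sr_involK.
move=> /(IH _ (pos_simple_reflection pa ai))[s' e1 e2].
exists (i :: s'); last by rewrite /= e2.
by rewrite wp_cons e1 !comp_lfunA reflection_comp ?simple_neq0.
Qed.
End Roots.

(** * Length in the Weyl group *)

Section Weyl.
Variables (R : realType) (E : vectType R) (ip : {dot E for @idfun R}).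
Variable Phi : based_root_system ip.
Implicit Types (a b : dual E) (w v u : 'End(E)) (s : seq 'I_(rs_rank Phi)).
Implicit Types (i j k : 'I_(rs_rank Phi)) (y c : E).
Local Notation al := (@simple _ _ _ Phi).
Local Notation rt := (root_seq Phi).
Local Notation pos := (pos_root Phi).
Local Notation sr := (@simple_refl _ _ _ Phi).
Local Notation wp := (@word_prod _ _ _ Phi).
Local Notation weyl := (weyl Phi).
Local Notation len := (len Phi).
Local Notation redex := (redex Phi).

Lemma dual_ip_coroot a b : a != 0 ->
  b (riesz ip a) = dual_ip ip a a / 2 * b (coroot ip a).
Proof.
move=> a0; rewrite /coroot [b (_ *: _)]linearZ /=.
rewrite -[_ *: b _]/(_ * b _); field.
by rewrite lt0r_neq0 // dual_ip_gt0.
Qed.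

(** Otherwise the squared norm of a, expanded in the simple roots, would be a sum of nonpositive
    terms. *)
Lemma pos_descent a : pos a -> exists i, 0 < (a (coroot ip (al i)) : R).
Proof.
move=> [ar /nat_combP[n en]]; apply: contrapT => h.
have := dual_ip_gt0 ip (root_neq0 ar); rewrite ltNge => /negP; apply.
have aE z : a z = \sum_i (n i)%:R * al i z.
  by rewrite {1}en sum_lfunE; apply: eq_bigr => i _; rewrite scale_lfunE.
rewrite dual_ipE aE; apply: sumr_le0 => i _.
apply: mulr_ge0_le0; first exact: ler0n.
rewrite -(rieszP ip) ipC rieszP dual_ip_coroot ?simple_neq0 //.
apply: mulr_ge0_le0; last by rewrite leNgt; apply/negP => hi; apply: h; exists i.
by rewrite divr_ge0 // ltW // dual_ip_gt0 // simple_neq0.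
Qed.

(** Induction on the height of a: a simple reflection s_i with positive pairing lowers the height,
    and conjugating by s_i recovers the reflection in a. *)
Lemma reflection_word a : a \in rt -> exists s, wp s = reflection ip a.
Proof.
wlog pa : a / pos a.
  move=> H ar; case: (root_pos_or_neg ar) => [pa|pa]; first exact: H.
  by rewrite -reflectionN; apply: H => //; case: pa.
move=> _; have /nat_combP[n en] := pa.2.
have [N] := ubnP (\sum_i n i)%N.
elim: N a n pa en => // N IH a n pa en nN.
have [i ki] := pos_descent pa.
have [->|ai] := eqVneq a (al i); first by exists [:: i]; rewrite wp1.
have pa' := pos_simple_reflection pa ai.
have /nat_combP[m em] := pa'.2.
have cm : (fun j => (m j)%:R) =1
          (fun j => (n j)%:R - a (coroot ip (al i)) *+ (j == i)).
  apply: (@simple_coordP _ _ _ Phi); rewrite -em comp_reflection.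
  under eq_bigr do rewrite scalerBl.
  rewrite sumrB -en; congr (_ - _).
  rewrite (bigD1 i) //= eqxx mulr1n big1 ?addr0 // => j' /negPf ->.
  by rewrite mulr0n scale0r.
have lt : (\sum_j m j < \sum_j n j)%N.
  rewrite -(ltr_nat R) !natr_sum (eq_bigr _ (fun j _ => cm j)) sumrB.
  have -> : \sum_j a (coroot ip (al i)) *+ (j == i) = a (coroot ip (al i)).
    by rewrite (bigD1 i) //= eqxx mulr1n big1 ?addr0 // => j /negPf ->.
  by rewrite ltrBlDr ltrDl.
have [s es] := IH _ m pa' em (leq_trans lt nN).
exists (i :: rcons s i).
by rewrite wp_cons wp_rcons es comp_lfunA reflection_comp ?simple_neq0 // sr_Kinvol.
Qed.

Lemma weylP w : weyl w <-> exists s, wp s = w.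
Proof.
split=> [[u ur ->]|[s <-]].
  elim: u ur => [|a u IH] ur; first by exists [::].
  have [|s es] := IH; first by move=> x xu; rewrite ur // inE xu orbT.
  have [|s' es'] := @reflection_word a; first by rewrite ur // inE eqxx.
  by exists (s' ++ s); rewrite wp_cat es es'.
exists [seq al i | i <- s].
  by move=> a /mapP[i _ ->]; exact: simple_roots.
by elim: s => //= i s ->.
Qed.

Lemma weyl_wp s : weyl (wp s).
Proof. by apply/weylP; exists s. Qed.
Hint Resolve weyl_wp : core.

Lemma weyl_sr i : weyl (sr i).
Proof. by rewrite -wp1. Qed.
Hint Resolve weyl_sr : core.

Lemma weyl1 : weyl \1%VF.
Proof. exact: (weyl_wp [::]). Qed.

Lemma weylM v w : weyl v -> weyl w -> weyl (v \o w)%VF.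
Proof. by move=> /weylP[s <-] /weylP[s' <-]; rewrite -wp_cat. Qed.

Lemma weylV w : weyl w -> weyl w^-1%VF.
Proof. by move=> /weylP[s <-]; rewrite wp_inv. Qed.

Lemma weyl_mulVw w : weyl w -> (w^-1 \o w = \1)%VF.
Proof. by move=> /weylP[s <-]; rewrite wp_inv wp_revl. Qed.

Lemma weyl_mulwV w : weyl w -> (w \o w^-1 = \1)%VF.
Proof. by move=> /weylP[s <-]; rewrite wp_inv wp_revr. Qed.

Lemma weyl_invM v w : weyl v -> weyl w -> ((v \o w)^-1 = w^-1 \o v^-1)%VF.
Proof.
by move=> /weylP[s <-] /weylP[s' <-]; rewrite -wp_cat !wp_inv rev_cat wp_cat.
Qed.

Lemma weyl_invK w : weyl w -> ((w^-1)^-1 = w)%VF.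
Proof. by move=> /weylP[s <-]; rewrite !wp_inv revK. Qed.

Lemma sr_inv i : (sr i)^-1%VF = sr i.
Proof. by rewrite -wp1 wp_inv. Qed.

Lemma weyl_root a w : weyl w -> a \in rt -> (a \o w)%VF \in rt.
Proof. by move=> /weylP[s <-]; exact: root_wp. Qed.

Lemma weyl_reflection_comp a w : weyl w ->
  (w \o reflection ip (a \o w)%VF)%VF = (reflection ip a \o w)%VF.
Proof.
move=> /weylP[s <-]; elim: s a => [|i s IH] a.
  by rewrite !comp_lfun1r comp_lfun1l.
rewrite wp_cons [(a \o _)%VF]comp_lfunA -comp_lfunA IH comp_lfunA.
by rewrite reflection_comp ?simple_neq0 // comp_lfunA.
Qed.

Lemma redexP w : weyl w -> reduced_expr w (redex w).
Proof.
move=> /weylP[s0 e0]; rewrite /Defs.redex; case: xgetP => [s _ //|h]; exfalso.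
have ex : exists n, `[< exists2 s, wp s = w & size s = n >].
  by exists (size s0); apply/asboolP; exists s0.
case: (ex_minnP ex) => n /asboolP[s es sn] nmin.
apply: (h s); split => // s' es'; rewrite sn; apply: nmin.
by apply/asboolP; exists s'.
Qed.

Lemma wp_redex w : weyl w -> wp (redex w) = w.
Proof. by case/redexP. Qed.

Lemma len_le s : (len (wp s) <= size s)%N.
Proof. by case: (redexP (weyl_wp s)) => _ h; exact: h. Qed.

Lemma lenV w : weyl w -> len w^-1%VF = len w.
Proof.
move=> ww; apply/eqP; rewrite eqn_leq.
have h v : weyl v -> (len v^-1%VF <= len v)%N.
  by move=> wv; rewrite -{1}(wp_redex wv) wp_inv (leq_trans (len_le _)) // size_rev.
by rewrite h //= -{1}(weyl_invK ww) h //; exact: weylV.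
Qed.

(** The exchange condition drops one letter from a reduced word of w to give s_i w. Prefixing s_i
    restores w, so the gain is exactly one letter. *)
Lemma len_srl_neg i w : weyl w -> pos (- (al i \o w))%VF ->
  len w = (len (sr i \o w)%VF).+1.
Proof.
move=> ww p; have [||s' es sz] := @strong_exchange _ _ _ Phi (al i) (redex w).
- exact: simple_pos.
- by rewrite wp_redex.
rewrite -/(simple_refl i) wp_redex // in es.
apply/eqP; rewrite eqn_leq; apply/andP; split; last first.
  by rewrite -es /Defs.len -sz ltnS len_le.
rewrite -{1}(sr_involK i w) -{1}(wp_redex (weylM (weyl_sr i) ww)).
by rewrite -wp_cons; exact: len_le.
Qed.

Lemma len_srl_pos i w : weyl w -> pos (al i \o w)%VF ->
  len (sr i \o w)%VF = (len w).+1.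
Proof.
move=> ww p; rewrite (@len_srl_neg i); last 1 first.
- by rewrite comp_lfunA comp_reflection_self ?simple_neq0 // comp_lfunNl opprK.
- by rewrite sr_involK.
by exact: weylM.
Qed.

Lemma simple_comp_pos_or_neg i w : weyl w ->
  pos (al i \o w)%VF \/ pos (- (al i \o w))%VF.
Proof.
by move=> ww; apply/root_pos_or_neg/weyl_root => //; exact: simple_roots.
Qed.

Lemma len_srlN i w : weyl w -> (len (sr i \o w)%VF < len w)%N ->
  pos (- (al i \o w))%VF.
Proof.
move=> ww; case: (simple_comp_pos_or_neg i ww) => // /(len_srl_pos ww) ->.
by rewrite ltnNge leqW.
Qed.

Lemma len_srr w i : weyl w -> len (w \o sr i)%VF = len (sr i \o w^-1)%VF.
Proof.
move=> ww; rewrite -(lenV (weylM ww (weyl_sr i))) weyl_invM // sr_inv //.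
Qed.

Lemma len_srr_pos i w : weyl w -> pos (al i \o w^-1)%VF ->
  len (w \o sr i)%VF = (len w).+1.
Proof. by move=> ww p; rewrite len_srr // len_srl_pos ?lenV //; exact: weylV. Qed.

Lemma len_srr_neg i w : weyl w -> pos (- (al i \o w^-1))%VF ->
  len w = (len (w \o sr i)%VF).+1.
Proof.
by move=> ww p; rewrite len_srr // -(len_srl_neg (weylV ww) p) lenV.
Qed.

(** Left multiplication by a simple reflection changes the length by exactly one, so any word
    computes the parity. This yields the sign for eps = -1. *)
Lemma odd_len s : odd (len (wp s)) = odd (size s).
Proof.
elim: s => [|i s IH] /=.
  by have := len_le [::]; rewrite leqn0 => /eqP ->.
rewrite -/(wp s) -IH; case: (simple_comp_pos_or_neg i (weyl_wp s)) => h.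
  by rewrite len_srl_pos.
by rewrite (len_srl_neg _ h) //= negbK.
Qed.

Lemma odd_lenM v w : weyl v -> weyl w -> odd (len (v \o w)%VF) = odd (len v + len w).
Proof.
move=> wv ww; rewrite -{1}(wp_redex wv) -{1}(wp_redex ww) -wp_cat odd_len size_cat //.
Qed.

Lemma reduced_cons i s : size (i :: s) = len (wp (i :: s)) ->
  size s = len (wp s) /\ pos (- (al i \o wp (i :: s)))%VF.
Proof.
move=> e; have e2 := len_le s; split; last first.
  by apply: len_srlN => //; rewrite [X in Defs.len _ X]sr_involK -e ltnS.
move: e; rewrite wp_cons /= => e.
apply/eqP; rewrite eqn_leq e2 andbT -ltnS e.
by case: (simple_comp_pos_or_neg i (weyl_wp s)) => h;
   [rewrite len_srl_pos|rewrite (len_srl_neg _ h) //; do 2 apply: leqW].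
Qed.

(** The first letter of a nonempty reduced word of w would be a left descent. *)
Lemma weyl_pos_eq1 w : weyl w -> (forall i, pos (al i \o w)%VF) -> w = \1%VF.
Proof.
move=> ww h; rewrite -(wp_redex ww).
case e : (redex w) => [//|i s].
have [|_] := @reduced_cons i s; first by rewrite -e wp_redex.
by rewrite -e wp_redex // => /(pos_neg_false (h i)).
Qed.
End Weyl.
#[export] Hint Resolve weyl_wp weyl_sr : core.

(** * Matsumoto's theorem *)

Fixpoint alt (T : Type) (i j : T) n : seq T :=
  if n is n'.+1 then i :: alt j i n' else [::].

Section Alternating.
Variable T : Type.
Implicit Types (i j : T) (n : nat).

Lemma size_alt i j n : size (alt i j n) = n.
Proof. by elim: n i j => //= n IH i j; rewrite IH. Qed.

Lemma alt_rcons i j n : alt i j n.+1 = rcons (alt i j n) (if odd n then j else i).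
Proof.
by elim: n i j => // n IH i j; rewrite -[LHS]/(i :: alt j i n.+1) IH /=; case: (odd n).
Qed.

Lemma alt_double i j n : alt i j n.*2 = alt i j n ++ rev (alt j i n).
Proof.
elim: n i j => // n IH i j; rewrite doubleS -[LHS]/(i :: alt j i n.*2.+1).
by rewrite alt_rcons odd_double IH /= rev_cons -rcons_cat.
Qed.

Lemma rev_alt i j n : rev (alt i j n) = if odd n then alt i j n else alt j i n.
Proof.
elim: n i j => // n IH i j; rewrite -[rev _]/(rev (i :: alt j i n)) rev_cons IH.
by rewrite [odd n.+1]/= if_neg; case: ifP => on; rewrite alt_rcons on.
Qed.
End Alternating.

Lemma alt_prodE (F : fieldType) (A : algType F) (I : Type) (b : I -> A) i j m :
  alt_prod (b i) (b j) m = \prod_(x <- alt i j m) b x.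
Proof.
rewrite /alt_prod; elim: m i j => [|m IH] i j; first by rewrite big_ord0 big_nil.
rewrite big_ord_recl big_cons -IH; congr (_ * _).
by apply: eq_bigr => k _; rewrite lift0 /=; case: (odd k).
Qed.

Section Matsumoto.
Variables (R : realType) (E : vectType R) (ip : {dot E for @idfun R}).
Variable Phi : based_root_system ip.
Implicit Types (a b : dual E) (w v u : 'End(E)) (s : seq 'I_(rs_rank Phi)).
Implicit Types (i j k : 'I_(rs_rank Phi)) (y c : E).
Local Notation al := (@simple _ _ _ Phi).
Local Notation pos := (pos_root Phi).
Local Notation sr := (@simple_refl _ _ _ Phi).
Local Notation wp := (@word_prod _ _ _ Phi).
Local Notation weyl := (weyl Phi).
Local Notation len := (len Phi).
Local Notation redex := (redex Phi).

Lemma wp_alt_double i j n :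
  wp (alt i j n.*2)
  = iter n (fun v => (sr i \o sr j \o v)%VF) \1%VF.
Proof.
elim: n => // n IH; rewrite doubleS [alt _ _ _]/= !wp_cons IH /=.
by rewrite comp_lfunA.
Qed.

(** Identifies the order of s_i s_j with the least positive length at which the two alternating
    words agree. *)
Lemma wp_alt_swap i j n :
  wp (alt i j n) = wp (alt j i n) <-> wp (alt i j n.*2) = \1%VF.
Proof.
rewrite alt_double wp_cat; split=> [->|e]; first exact: wp_revr.
rewrite -[RHS]comp_lfun1l -e -comp_lfunA wp_revl.
by rewrite comp_lfun1r.
Qed.

(** Positivity can be lost only when the current root equals the next simple root. Conjugating
    reflections then shows that the two alternating words of the next length agree. *)
Lemma alt_pos i j n : (forall m, (0 < m <= n)%N -> wp (alt i j m) <> wp (alt j i m)) ->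
  pos (al i \o wp (alt j i n))%VF.
Proof.
elim: n => [|n IH] h; first by rewrite comp_lfun1r; exact: simple_pos.
rewrite alt_rcons wp_rcons comp_lfunA; apply: pos_simple_reflection.
  by apply: IH => m /andP[m0 mn]; apply: h; rewrite m0 leqW.
apply/eqP => e; apply: (h n.+1); first by rewrite ltnS leqnn.
rewrite wp_cons alt_rcons wp_rcons.
by have := weyl_reflection_comp (al i) (weyl_wp (alt j i n)); rewrite e => <-.
Qed.

Lemma comp_span2 i j (p q : R) s : all [pred x | (x == i) || (x == j)] s ->
  exists p' q' : R, ((p *: al i + q *: al j) \o wp s)%VF = p' *: al i + q' *: al j.
Proof.
elim: s p q => [|x s IH] p q; first by exists p, q; rewrite comp_lfun1r.
move=> /= /andP[xij] /IH{}IH; rewrite -/(wp s) comp_lfunA comp_reflection.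
set r := ((p *: al i + q *: al j) _ : R).
case/orP: xij => /eqP ->.
  have [p' [q' e]] := IH (p - r) q; exists p', q'; rewrite -e; congr (_ \o _)%VF.
  by rewrite scalerBl addrAC.
have [p' [q' e]] := IH p (q - r); exists p', q'; rewrite -e; congr (_ \o _)%VF.
by rewrite scalerBl addrA.
Qed.

(** [al k \o wp s] stays in the span of alpha_i and alpha_j. Positivity and uniqueness of
    coordinates make its coefficients natural numbers, and composing with w makes both simple roots
    negative. *)
Lemma pos_span2 i j w s : weyl w -> i != j ->
  all [pred x | (x == i) || (x == j)] s ->
  pos (- (al i \o w))%VF -> pos (- (al j \o w))%VF ->
  forall k, (k == i) || (k == j) ->
  pos (al k \o wp s)%VF -> pos (- (al k \o wp s \o w))%VF.
Proof.
move=> ww ij sij [_ /nat_combP[ni ei]] [_ /nat_combP[nj ej]] k kij pk.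
have [p [q e]] : exists p q : R, (al k \o wp s)%VF = p *: al i + q *: al j.
  case/orP: kij => /eqP ->.
    by have [p [q e]] := comp_span2 1 0 sij; exists p, q;
       rewrite -e scale1r scale0r addr0.
  by have [p [q e]] := comp_span2 0 1 sij; exists p, q;
     rewrite -e scale1r scale0r add0r.
have /nat_combP[n en] := pk.2.
have cn : (fun x => (n x)%:R) =1 (fun x => p *+ (x == i) + q *+ (x == j)).
  apply: (@simple_coordP _ _ _ Phi); rewrite -en e.
  under eq_bigr do rewrite scalerDl.
  rewrite big_split /= (bigD1 i) //= [X in _ = _ + X](bigD1 j) //= !eqxx !mulr1n.
  rewrite !big1 ?addr0 // => x /negPf ->; by rewrite mulr0n scale0r.
have ep : p = (n i)%:R by rewrite cn eqxx (negPf ij) mulr1n mulr0n addr0.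
have ejq : q = (n j)%:R by rewrite cn eqxx eq_sym (negPf ij) mulr1n mulr0n add0r.
split; first by case: pk => pk _; exact: (root_opp (weyl_root ww pk)).
apply/nat_combP; exists (fun x => n i * ni x + n j * nj x)%N.
under eq_bigr do rewrite natrD !natrM scalerDl -!scalerA.
rewrite big_split /= -!scaler_sumr -ei -ej -ep -ejq e.
by rewrite comp_lfunDl -!comp_lfunZl opprD !scalerN.
Qed.

Lemma all_alt i j (x y : 'I_(rs_rank Phi)) n : (x == i) || (x == j) -> (y == i) || (y == j) ->
  all [pred x | (x == i) || (x == j)] (alt x y n).
Proof. by move=> hx hy; elim: n x y hx hy => //= n IH x y hx hy; rewrite hx IH. Qed.

(* Both [i] and [j] are left descents of [w], so an alternating word can be
   stripped off [w] as long as it is shorter than the order of [s_i s_j]. *)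
Lemma len_strip_alt i j w n : weyl w -> i != j ->
  pos (- (al i \o w))%VF -> pos (- (al j \o w))%VF ->
  (forall m, (0 < m < n)%N -> wp (alt i j m) <> wp (alt j i m)) ->
  (len (wp (rev (alt i j n)) \o w)%VF + n)%N = len w.
Proof.
move=> ww ij pi pj; elim: n => [|n IH] h; first by rewrite addn0 comp_lfun1l.
rewrite -IH; last by move=> m /andP[m0 mn]; apply: h; rewrite m0 leqW.
rewrite alt_rcons rev_rcons wp_cons -comp_lfunA.
set x := if odd n then j else i.
have pos_neg : pos (- (al x \o (wp (rev (alt i j n)) \o w)))%VF.
  rewrite comp_lfunA; apply: (@pos_span2 i j) => //.
  - by rewrite all_rev all_alt ?eqxx ?orbT.
  - by rewrite /x; case: ifP; rewrite eqxx ?orbT.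
  rewrite rev_alt /x; case: ifP => _; apply: alt_pos => m mn; last exact: h.
  by move=> e; apply: (h m mn).
rewrite [in RHS](len_srl_neg _ pos_neg) ?addSnnS //.
exact: weylM.
Qed.

(** Two common left descents of w bound the order of s_i s_j by [len w]: otherwise more than [len w]
    letters could be stripped off w. *)
Lemma cox_order_ex i j w : weyl w -> i != j ->
  pos (- (al i \o w))%VF -> pos (- (al j \o w))%VF ->
  exists m, [/\ cox_order i j m, (0 < m)%N, wp (alt i j m) = wp (alt j i m)
    & forall n, (0 < n < m)%N -> wp (alt i j n) <> wp (alt j i n)].
Proof.
move=> ww ij pi pj.
pose P n := `[< (0 < n)%N /\ wp (alt i j n) = wp (alt j i n) >].
have ex : exists n, P n.
  apply: contrapT => h.
  have := @len_strip_alt i j w (len w).+1 ww ij pi pj.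
  move=> e; suff : ((len w).+1 <= len w)%N by rewrite ltnn.
  rewrite -[X in (_ <= X)%N]e ?leq_addl // => m /andP[m0 _] em.
  by apply: h; exists m; apply/asboolP.
case: (ex_minnP ex) => m /asboolP[m0 em] mmin; exists m.
have hlt n : (0 < n < m)%N -> wp (alt i j n) <> wp (alt j i n).
  move=> /andP[n0 nm] en; move: nm; rewrite ltnNge mmin //.
  by apply/asboolP.
split=> //; split=> //; first by rewrite -wp_alt_double; apply/wp_alt_swap.
by move=> n nm; rewrite -wp_alt_double => /wp_alt_swap; exact: hlt.
Qed.

(** A common first letter is cancelled. If the first letters i and j differ, both are left descents
    of w, and stripping either alternating word of length m, the order of s_i s_j, leaves the same
    z. So w has two further reduced words, the alternating ones followed by [redex z]. Each given
    word shares its first letter with one of these, so induction compares the tails; the two new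
    words differ by a braid relation. *)
Lemma matsumoto (A : nzRingType) (b : 'I_(rs_rank Phi) -> A) :
  (forall i j m, i != j -> cox_order i j m ->
     \prod_(x <- alt i j m) b x = \prod_(x <- alt j i m) b x) ->
  forall s s', wp s = wp s' -> size s = len (wp s) -> size s' = len (wp s') ->
  \prod_(x <- s) b x = \prod_(x <- s') b x.
Proof.
move=> braid s; have [n] := ubnP (size s); elim: n s => // n IH.
move=> [|i s] sn [|j s'] // e rs rs'.
- by move: rs'; rewrite -e -rs.
- by move: rs; rewrite e -rs'.
have [es pi] := reduced_cons rs; have [es' pj] := reduced_cons rs'.
have [eij|ij] := eqVneq i j.
  rewrite eij in e *; rewrite !big_cons; congr (_ * _); apply: IH => //.
  by rewrite -[LHS](sr_involK j) -wp_cons e wp_cons sr_involK.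
set w := wp (i :: s) in e rs pi; rewrite -e in rs' pj.
have [m [co m0 em hm]] := cox_order_ex (weyl_wp _) ij pi pj.
pose z := (wp (rev (alt i j m)) \o w)%VF.
have ww : weyl w by exact: weyl_wp.
have wz : weyl z by exact: weylM (weyl_wp _) ww.
have lz := len_strip_alt (weyl_wp _) ij pi pj hm.
have ez : z = (wp (rev (alt j i m)) \o w)%VF.
  by rewrite /z -!wp_inv em.
case: m => // m in co m0 em hm z wz lz ez *.
have wi : wp (alt i j m.+1 ++ redex z) = w.
  by rewrite wp_cat wp_redex // /z comp_lfunA wp_revr comp_lfun1l.
have wj : wp (alt j i m.+1 ++ redex z) = w.
  by rewrite wp_cat wp_redex // ez comp_lfunA wp_revr comp_lfun1l.
have sz i' j' : size (alt i' j' m.+1 ++ redex z) = len w.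
  by rewrite size_cat size_alt addnC.
have step (x y : 'I_(rs_rank Phi)) s0 :
    wp (x :: s0) = w -> size (x :: s0) = len w -> size s0 = len (wp s0) ->
    wp (alt x y m.+1 ++ redex z) = w ->
    \prod_(i <- x :: s0) b i = \prod_(i <- alt x y m.+1 ++ redex z) b i.
  move=> ew sw es0 ea; rewrite [alt _ _ _ ++ _]/= !big_cons; congr (_ * _).
  have ew2 : wp s0 = wp (alt y x m ++ redex z).
    by rewrite -[LHS](sr_involK x) -wp_cons ew -ea wp_cons sr_involK.
  apply: IH => //; first by move: sn => /=; rewrite ltnS -/(size (i :: s)) rs -sw.
  have [|//] := @reduced_cons _ _ _ _ x (alt y x m ++ redex z).
  by rewrite -[x :: _]/(alt x y m.+1 ++ redex z) ea sz.
rewrite (step i j) // (step j i) // !big_cat; congr (_ * _).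
exact: braid.
Qed.
End Matsumoto.

(** * The longest element and minimal coset representatives *)

Section Cosets.
Variables (R : realType) (E : vectType R) (ip : {dot E for @idfun R}).
Variable Phi : based_root_system ip.
Implicit Types (a b : dual E) (w v u : 'End(E)) (s : seq 'I_(rs_rank Phi)).
Implicit Types (i j k : 'I_(rs_rank Phi)) (y c : E).
Local Notation al := (@simple _ _ _ Phi).
Local Notation pos := (pos_root Phi).
Local Notation sr := (@simple_refl _ _ _ Phi).
Local Notation wp := (@word_prod _ _ _ Phi).
Local Notation weyl := (weyl Phi).
Local Notation len := (len Phi).
Local Notation redex := (redex Phi).

Lemma nat_comb_sum (n : 'I_(rs_rank Phi) -> nat) (f : 'I_(rs_rank Phi) -> dual E) :
  (forall i, n i != 0%N -> nat_comb al (f i)) ->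
  nat_comb al (\sum_i (n i)%:R *: f i).
Proof.
move=> h; have /choice[m hm] : forall i, exists m : 'I_(rs_rank Phi) -> nat,
    n i != 0%N -> f i = \sum_j (m j)%:R *: al j.
  move=> i; have [_|/h /nat_combP[m em]] := eqVneq (n i) 0%N; first by exists (fun=> 0%N).
  by exists m.
apply/nat_combP; exists (fun j => \sum_i n i * m i j)%N.
rewrite [LHS](_ : _ = \sum_i \sum_j (n i * m i j)%:R *: al j); last first.
  apply: eq_bigr => i _; have [->|/hm ->] := eqVneq (n i) 0%N.
    by rewrite scale0r big1 // => j _; rewrite mul0n scale0r.
  by rewrite scaler_sumr; apply: eq_bigr => j _; rewrite scalerA natrM.
by rewrite exchange_big; apply: eq_bigr => j _; rewrite natr_sum scaler_suml.
Qed.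

Lemma comp_lfun_sum (n : 'I_(rs_rank Phi) -> nat) w :
  ((\sum_i (n i)%:R *: al i) \o w)%VF = \sum_i (n i)%:R *: (al i \o w)%VF.
Proof.
apply/lfunP => y; rewrite comp_lfunE !sum_lfunE; apply: eq_bigr => i _.
by rewrite !scale_lfunE comp_lfunE.
Qed.

Section Longest.
Variable w0 : 'End(E).
Hypothesis w0_longest : longest Phi w0.

Lemma longest_weyl : weyl w0. Proof. by case: w0_longest. Qed.
Local Hint Resolve longest_weyl : core.

Lemma longest_simple i : pos (- (al i \o w0))%VF.
Proof.
apply: len_srlN => //; rewrite ltnNge.
case: (simple_comp_pos_or_neg i longest_weyl) => p.
  have := w0_longest.2 _ (weylM (weyl_sr i) longest_weyl).
  by rewrite len_srl_pos // ltnn.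
by rewrite (len_srl_neg _ p) // ltnn.
Qed.

Lemma longest_neg a : pos a -> pos (- (a \o w0))%VF.
Proof.
move=> [ar /nat_combP[n en]]; split.
  by apply: root_opp; apply: weyl_root.
have -> : - (a \o w0)%VF = \sum_i (n i)%:R *: (- (al i \o w0))%VF.
  by rewrite en comp_lfun_sum -sumrN; apply: eq_bigr => i _; rewrite scalerN.
by apply: nat_comb_sum => i _; case: (longest_simple i).
Qed.

(** w0 makes every positive root negative, so its square keeps the simple roots positive. *)
Lemma longest_invol : (w0 \o w0 = \1)%VF.
Proof.
apply: (weyl_pos_eq1 (weylM longest_weyl longest_weyl)) => i.
rewrite comp_lfunA; have := longest_neg (longest_simple i).
by rewrite comp_lfunNl opprK.
Qed.

Lemma longest_inv : (w0^-1 = w0)%VF.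
Proof. by apply: lfun_inv_uniq; exact: longest_invol. Qed.

(* Conjugation by [w0] permutes the simple roots up to sign, because
   [w0 s_j w0] makes only one positive root negative. *)
Lemma longest_star j : exists k, al k = - (al j \o w0)%VF.
Proof.
pose u := (w0 \o sr j \o w0)%VF.
have wu : weyl u by rewrite /u; do 2 apply: weylM => //.
have u1 : u <> \1%VF.
  move=> e; apply: (@sr_neq1 _ _ _ Phi j).
  have -> : sr j = (w0 \o u \o w0)%VF.
    rewrite /u !comp_lfunA longest_invol comp_lfun1l.
    by rewrite -comp_lfunA longest_invol comp_lfun1r.
  by rewrite e comp_lfun1r longest_invol.
have [k kn] : exists k, ~ pos (al k \o u)%VF.
  apply: contrapT => h; apply: u1; apply: (weyl_pos_eq1 wu) => k.
  by apply: contrapT => hk; apply: h; exists k.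
exists k; have pk := longest_simple k.
have [e|ne] := eqVneq (- (al k \o w0))%VF (al j).
  by rewrite -e comp_lfunNl opprK -comp_lfunA longest_invol comp_lfun1r.
have := longest_neg (pos_simple_reflection pk ne).
by move=> p; case: kn; move: p; rewrite !comp_lfunNl opprK /u -!comp_lfunA.
Qed.

Lemma longest_star_sr j k : al k = - (al j \o w0)%VF ->
  (w0 \o sr k = sr j \o w0)%VF.
Proof.
by move=> e; rewrite /simple_refl e reflectionN (weyl_reflection_comp _ longest_weyl).
Qed.

(** Let x be the image of the coroot of alpha_k under w0. Evaluating w0 s_k = s_j w0 on that coroot
    gives - x = x + 2 [simple_coroot j]. *)
Lemma longest_star_coroot j k : al k = - (al j \o w0)%VF ->
  w0 (simple_coroot k) = - simple_coroot j.
Proof.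
move=> e; have ek := longest_star_sr e.
have e1 : sr k (simple_coroot k) = - simple_coroot k.
  rewrite /simple_refl reflectionE coroot_self ?simple_neq0 //.
  by rewrite scaler_nat mulr2n opprD addrA subrr add0r.
have e2 : al j (w0 (simple_coroot k)) = -2.
  have -> : al j (w0 (simple_coroot k)) = - al k (simple_coroot k).
    by rewrite e opp_lfunE opprK comp_lfunE.
  by rewrite coroot_self ?simple_neq0.
have : w0 (sr k (simple_coroot k)) = sr j (w0 (simple_coroot k)).
  by rewrite -!comp_lfunE ek.
rewrite e1 linearN /= /simple_refl reflectionE e2 -/(simple_coroot j).
rewrite scaleNr opprK => /esym/eqP; rewrite -subr_eq0 opprK addrAC -mulr2n.
by rewrite -scaler_nat -scalerDr scaler_eq0 pnatr_eq0 /= addr_eq0 => /eqP.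
Qed.
End Longest.

(** * Stabilizers of a dominant point and minimal coset representatives *)

Section Stabilizer.
Variable c : E.
Hypothesis c_dom : forall i, 0 <= (al i c : R).

Lemma sr_fixP i y : sr i y = y <-> al i y = 0.
Proof.
rewrite /simple_refl reflectionE; split=> [|->]; last by rewrite scale0r subr0.
move=> e; have /eqP : al i y *: coroot ip (al i) = 0.
  by rewrite -[LHS](subKr y) e subrr.
rewrite scaler_eq0 => /orP[/eqP //|/eqP e2].
have := coroot_self ip (simple_neq0 i); rewrite e2 linear0 => /esym /eqP.
by rewrite pnatr_eq0.
Qed.

Lemma dom_ge0 a : pos a -> 0 <= (a c : R).
Proof.
move=> [_ /nat_combP[n ->]]; rewrite sum_lfunE; apply: sumr_ge0 => i _.
by rewrite scale_lfunE mulr_ge0.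
Qed.

Lemma dominant_word s : size s = len (wp s) ->
  (forall i, 0 <= (al i (wp s c) : R)) ->
  wp s c = c /\ forall i, i \in s -> sr i c = c.
Proof.
elim: s => [|i s IH] rs h; first by rewrite /= id_lfunE.
have [rs1 p] := reduced_cons rs.
have fixw : sr i (wp (i :: s) c) = wp (i :: s) c.
  apply/sr_fixP/eqP; rewrite eq_le h andbT -oppr_ge0.
  by have := dom_ge0 p; rewrite opp_lfunE comp_lfunE.
have e1 : wp s c = wp (i :: s) c.
  by rewrite -fixw wp_cons -!comp_lfunE sr_involK.
have [||e2 h2] := IH => //; first by move=> j; rewrite e1.
split; first by rewrite -e1.
by move=> j; rewrite inE => /orP[/eqP ->|/h2 //]; rewrite -{1}e2 e1 fixw -e1.
Qed.

Lemma dominant_orbit w : weyl w -> (forall i, 0 <= (al i (w c) : R)) -> w c = c.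
Proof.
move=> ww; rewrite -(wp_redex ww) => h.
have [||//] := @dominant_word (redex w) => //.
by rewrite wp_redex.
Qed.

Lemma stab_letters w : weyl w -> w c = c -> forall i, i \in redex w -> sr i c = c.
Proof.
move=> ww wc; have [||_] := @dominant_word (redex w); last by [].
  by rewrite wp_redex.
by move=> i; rewrite wp_redex // wc.
Qed.

Lemma stab_sr k : sr k c = c -> weyl_stab Phi c (sr k).
Proof. by []. Qed.

Lemma min_reps_pos u k : min_reps Phi c u -> sr k c = c -> pos (al k \o u^-1)%VF.
Proof.
move=> [wu umin] kc; case: (simple_comp_pos_or_neg k (weylV wu)) => // p.
have := umin (sr k) (stab_sr kc); rewrite (len_srr_neg wu p).
by rewrite ltnn.
Qed.

Lemma min_reps_dec w : weyl w ->
  exists u v, [/\ min_reps Phi c u, weyl_stab Phi c v & w = (u \o v)%VF].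
Proof.
move=> ww; pose P n := `[< exists2 v, weyl_stab Phi c v & len (w \o v)%VF = n >].
have ex : exists n, P n.
  exists (len (w \o \1)%VF); apply/asboolP; exists \1%VF => //.
  by split; [exact: weyl1|rewrite id_lfunE].
case: (ex_minnP ex) => n /asboolP[v [wv vc] vn] nmin.
exists (w \o v)%VF, (v^-1)%VF; split.
- split; first exact: weylM.
  move=> v' [wv' vc']; rewrite vn; apply: nmin; apply/asboolP.
  exists (v \o v')%VF; last by rewrite comp_lfunA.
  by split; [exact: weylM|rewrite comp_lfunE vc' vc].
- split; first exact: weylV.
  by rewrite -{1}vc -comp_lfunE (weyl_mulVw wv) id_lfunE.
- by rewrite -comp_lfunA (weyl_mulwV wv) comp_lfun1r.
Qed.

(** By dominance the nonnegative terms of a(c) = 0 vanish one by one, so a involves only simple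
    roots that vanish at c. *)
Lemma stab_root_pos u a : weyl u -> (forall k, sr k c = c -> pos (al k \o u^-1)%VF) ->
  pos a -> a c = 0 -> pos (a \o u^-1)%VF.
Proof.
move=> wu hu [ar /nat_combP[n en]] ac; split.
  by apply: weyl_root => //; exact: weylV.
rewrite en comp_lfun_sum; apply: nat_comb_sum => i ni.
suff ic : sr i c = c by case: (hu i ic).
apply/sr_fixP/eqP.
move: ac; rewrite en sum_lfunE => /eqP; rewrite psumr_eq0; last first.
  by move=> k _; rewrite scale_lfunE mulr_ge0.
move=> /allP /(_ i (mem_index_enum i)).
by rewrite scale_lfunE [_ == _]mulf_eq0 pnatr_eq0 (negPf ni).
Qed.

(** Put v = u^-1 u', which fixes c, and suppose that [al k \o v^-1] is negative. Evaluation at c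
    gives alpha_k(c) = 0. The hypothesis on u' then makes [al k \o v^-1 \o u^-1] positive, whereas
    [stab_root_pos] for u makes its opposite positive. *)
Lemma stab_reps_uniq u u' : weyl u -> weyl u' ->
  (forall k, sr k c = c -> pos (al k \o u^-1)%VF) ->
  (forall k, sr k c = c -> pos (al k \o u'^-1)%VF) ->
  u c = u' c -> u = u'.
Proof.
move=> wu wu' hu hu' e; pose v := (u^-1 \o u')%VF.
have wv : weyl v by apply: weylM => //; exact: weylV.
have vc : v c = c by rewrite comp_lfunE -e -comp_lfunE (weyl_mulVw wu) id_lfunE.
have vc' : v^-1%VF c = c by rewrite -{1}vc -comp_lfunE (weyl_mulVw wv) id_lfunE.
have eu' : u' = (u \o v)%VF by rewrite /v comp_lfunA (weyl_mulwV wu) comp_lfun1l.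
suff v1 : v^-1%VF = \1%VF.
  by rewrite eu' -[v]comp_lfun1l -v1 (weyl_mulVw wv) comp_lfun1r.
apply: (weyl_pos_eq1 (weylV wv)) => k.
case: (simple_comp_pos_or_neg k (weylV wv)) => // p; exfalso.
have kc0 : al k c = 0.
  apply/eqP; rewrite eq_le c_dom andbT -oppr_ge0.
  by have := dom_ge0 p; rewrite opp_lfunE comp_lfunE vc'.
have kc : sr k c = c by apply/sr_fixP.
have := hu' k kc; rewrite eu' (weyl_invM wu wv) comp_lfunA => q.
apply: (pos_neg_false q); rewrite -comp_lfunNl.
by apply: stab_root_pos => //; rewrite opp_lfunE comp_lfunE vc' kc0 oppr0.
Qed.

(** Replaces the comparison of lengths by signs of roots. For the converse, the minimal
    representative of the coset meets the same criterion and takes the same value at c, so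
    uniqueness applies. *)
Lemma min_repsP u : min_reps Phi c u <->
  weyl u /\ forall k, sr k c = c -> pos (al k \o u^-1)%VF.
Proof.
split=> [mu|[wu hu]]; first by split=> [|k]; [case: mu|exact: min_reps_pos].
have [u' [v [mu' [_ vc] e]]] := min_reps_dec wu.
suff -> : u = u' by [].
apply: stab_reps_uniq => //; first by case: mu'.
  by move=> k; exact: min_reps_pos.
by rewrite e comp_lfunE vc.
Qed.

Lemma min_reps_uniq u u' : min_reps Phi c u -> min_reps Phi c u' ->
  u c = u' c -> u = u'.
Proof. by move=> /min_repsP[? ?] /min_repsP[? ?]; exact: stab_reps_uniq. Qed.

(** If no such k existed, the positivity criterion would carry over from u to s_j u. Both take the
    same value at c, so uniqueness would give s_j u = u. *)
Lemma min_reps_fix u j : min_reps Phi c u -> sr j (u c) = u c ->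
  exists2 k, sr k c = c & (al k \o u^-1)%VF = al j.
Proof.
move=> mu fixj; have wu : weyl u by case: mu.
apply: contrapT => h; apply: (@sr_neq1 _ _ _ Phi j).
suff e : u = (sr j \o u)%VF.
  by rewrite -[LHS]comp_lfun1r -(weyl_mulwV wu) comp_lfunA -e.
apply: min_reps_uniq => //; last by rewrite comp_lfunE.
apply/min_repsP; split; first exact: weylM.
move=> k kc; rewrite (weyl_invM (weyl_sr j) wu) sr_inv comp_lfunA.
apply: pos_simple_reflection; first exact: min_reps_pos.
by apply/eqP => e; apply: h; exists k.
Qed.

Lemma min_reps_fix_sr u j k : weyl u -> (al k \o u^-1)%VF = al j ->
  (sr j \o u = u \o sr k)%VF.
Proof.
move=> wu e; have := weyl_reflection_comp (al j) wu.
by rewrite -{1}e -comp_lfunA (weyl_mulVw wu) comp_lfun1r => <-.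
Qed.

(** s_j can spoil the positivity criterion only at a k in J_c with [al k \o u^-1] equal to alpha_j,
    and then alpha_j(u c) = alpha_k(c) = 0. *)
Lemma min_reps_move u j : min_reps Phi c u -> sr j (u c) <> u c ->
  min_reps Phi c (sr j \o u)%VF.
Proof.
move=> mu nfix; have wu : weyl u by case: mu.
apply/min_repsP; split; first exact: weylM.
move=> k kc; rewrite (weyl_invM (weyl_sr j) wu) sr_inv comp_lfunA.
apply: pos_simple_reflection; first exact: min_reps_pos.
apply/eqP => e; apply: nfix; apply/sr_fixP.
rewrite -e -comp_lfunE -comp_lfunA (weyl_mulVw wu) comp_lfun1r.
exact/sr_fixP.
Qed.

(** Without such an ascent u c is antidominant. Then w0 u c is a dominant point in the orbit of c,
    hence c itself, and u c = w0 c = w0c c. *)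
Lemma min_reps_ascent w0 w0c v u : longest Phi w0 -> w0 = (w0c \o v)%VF ->
  min_reps Phi c w0c -> v c = c -> min_reps Phi c u -> u <> w0c ->
  exists j, sr j (u c) <> u c /\ pos (al j \o u)%VF.
Proof.
move=> lw0 e mw0 vc mu; apply: contra_notP => h.
have wu : weyl u by case: mu.
have antidom j : al j (u c) <= (0 : R).
  case: (simple_comp_pos_or_neg j wu) => p.
    suff /sr_fixP -> : sr j (u c) = u c by [].
    by apply: contrapT => q; apply: h; exists j.
  by have := dom_ge0 p; rewrite opp_lfunE comp_lfunE oppr_ge0.
have w0u : w0 (u c) = c.
  rewrite -comp_lfunE; apply: dominant_orbit.
    by apply: weylM => //; case: lw0.
  move=> i; have [k ek] := longest_star lw0 i.
  have -> : al i ((w0 \o u)%VF c) = - al k (u c).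
    by rewrite ek opp_lfunE opprK !comp_lfunE.
  by rewrite oppr_ge0.
apply: min_reps_uniq => //; rewrite -[in RHS]vc -[RHS]comp_lfunE -e -[in RHS]w0u.
by rewrite -[RHS]comp_lfunE longest_invol // id_lfunE.
Qed.
End Stabilizer.
End Cosets.

(** * The group algebra *)

Section ModuleIdentities.
Variables (F : fieldType) (V : lmodType F) (S1 S2 : {linear V -> V}).
Implicit Types (k a q : F) (Y h P N X : V).

Lemma lincomb_scale a k q (x x' y y' : V) :
  a *: (k *: x + x') + q *: (k *: y + y')
  = k *: (a *: x + q *: y) + (a *: x' + q *: y').
Proof.
rewrite !scalerDr !scalerA (mulrC a) (mulrC q).
by rewrite addrACA.
Qed.

Lemma lincomb_scale_add k q (x x' y y' z z' : V) :
  k *: x + x' + q *: (k *: y + y' + (k *: z + z'))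
  = k *: (x + q *: (y + z)) + (x' + q *: (y' + z')).
Proof.
have := lincomb_scale 1 k q x x' (y + z) (y' + z'); rewrite !scale1r => <-.
by rewrite [k *: y + y' + _]addrACA -scalerDr.
Qed.

Let lin_combE (S : {linear V -> V}) c d x y :
  S (c *: x + d *: y) = c *: S x + d *: S y.
Proof. by rewrite linearD !linearZ. Qed.

Let lin_combE1 (S : {linear V -> V}) c x y : S (c *: x + y) = c *: S x + S y.
Proof. exact: linearP. Qed.

Let linZE (S : {linear V -> V}) c x : S (c *: x) = c *: S x.
Proof. exact: linearZ. Qed.

Let linDE (S : {linear V -> V}) x y : S (x + y) = S x + S y.
Proof. exact: raddfD. Qed.

(** With [lincomb_move], the linear bookkeeping of the induction in [qpT_coset], separated from the
    group algebra. S1 and S2 will be translations by points of the orbit of c. *)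
Lemma lincomb_fix k a q Y h P N :
  k *: (a *: S1 Y + q *: S1 h) + S1 (a *: P + q *: N)
  = S1 (a *: (k *: Y + P) + q *: (k *: h + N)).
Proof.
rewrite !(lin_combE S1) !(lin_combE1 S1).
by rewrite !scalerDr !scalerA ![k * _]mulrC addrACA.
Qed.

Lemma lincomb_move k q Y h X P N X' :
  k *: (S1 Y + q *: S2 (h + X)) + (S1 P + q *: S2 (N + X'))
  = S1 (k *: Y + P) + q *: S2 (k *: h + N + (k *: X + X')).
Proof.
rewrite -addrA (lin_combE1 S1) !(linDE S2, linZE S2).
rewrite !scalerDr !scalerA ![k * _]mulrC -!addrA; congr (_ + _).
rewrite [RHS]addrCA; congr (_ + _); rewrite [LHS]addrCA; congr (_ + _).
by rewrite addrCA.
Qed.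
End ModuleIdentities.

Section GroupAlgebra.
Variables (R : realType) (E : vectType R) (F : fieldType).
Local Notation A := {malg F[E]}.
Implicit Types (f g h : A) (y z v : E) (S : set E) (k : F) (w : 'End(E)).

Lemma lin_extEw (V : lmodType F) (phi : E -> V) f (d : {fset E}) :
  (msupp f `<=` d)%fset -> lin_ext phi f = \sum_(y <- d) f@_y *: phi y.
Proof.
move=> fd; rewrite /lin_ext (big_fset_incl _ fd) // => y yd yf.
by rewrite (mcoeff_outdom yf) scale0r.
Qed.

Lemma lin_ext_linear (V : lmodType F) (phi : E -> V) : linear (lin_ext phi).
Proof.
move=> k f g; pose d := (msupp f `|` msupp g)%fset.
have sub : (msupp (k *: f + g) `<=` d)%fset.
  apply: fsubset_trans (msuppD_le _ _) _.
  by apply: fsetUSS => //; exact: msuppZ_le.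
rewrite (lin_extEw _ sub) (@lin_extEw _ _ f d) ?fsubsetUl //.
rewrite (@lin_extEw _ _ g d) ?fsubsetUr // scaler_sumr -big_split.
by apply: eq_bigr => y _; rewrite mcoeffD mcoeffZ scalerDl scalerA.
Qed.

HB.instance Definition _ (V : lmodType F) (phi : E -> V) :=
  GRing.isLinear.Build F A V _ (lin_ext phi) (lin_ext_linear phi).

Lemma lin_extU (V : lmodType F) (phi : E -> V) y : lin_ext phi << y >> = phi y.
Proof.
by rewrite /lin_ext msuppU oner_eq0 big_seq_fset1 mcoeffUU scale1r.
Qed.

HB.instance Definition _ w :=
  GRing.Linear.copy (@wact R E F w) (lin_ext (fun y => << w y >> : A)).

Lemma wactU w y : wact w << y >> = << w y >> :> A.
Proof. exact: lin_extU. Qed.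

Lemma gspanP S f : gspan S f <-> forall y, f@_y != 0 -> S y.
Proof. by split=> h y; [rewrite mcoeff_neq0|rewrite -mcoeff_neq0]; exact: h. Qed.

Lemma gspan0 S : gspan S (0 : A).
Proof. by apply/gspanP => y; rewrite mcoeff0 eqxx. Qed.

Lemma gspan_lin S k f g : gspan S f -> gspan S g -> gspan S (k *: f + g).
Proof.
move=> /gspanP hf /gspanP hg; apply/gspanP => y; rewrite mcoeffD mcoeffZ.
have [f0|/hf //] := eqVneq (f@_y) 0; have [g0|/hg //] := eqVneq (g@_y) 0.
by rewrite f0 g0 mulr0 addr0 eqxx.
Qed.

Lemma gspanD S f g : gspan S f -> gspan S g -> gspan S (f + g).
Proof. by move=> hf hg; rewrite -[f]scale1r; exact: gspan_lin. Qed.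

Lemma gspanZ S k f : gspan S f -> gspan S (k *: f).
Proof. by move=> hf; rewrite -[_ *: _]addr0; apply: gspan_lin => //; exact: gspan0. Qed.

Lemma gspanN S f : gspan S f -> gspan S (- f).
Proof. by rewrite -scaleN1r; exact: gspanZ. Qed.

Lemma gspanB S f g : gspan S f -> gspan S g -> gspan S (f - g).
Proof. by move=> hf /gspanN; exact: gspanD. Qed.

Lemma gspanU S y : S y -> gspan S (<< y >> : A).
Proof.
move=> Sy; apply/gspanP => z; rewrite mcoeffU; have [<-//|_] := eqVneq y z.
by rewrite mulr0n eqxx.
Qed.

Lemma gspan_ind S (P : A -> Prop) : P 0 ->
  (forall k y g, S y -> gspan S g -> P g -> P (k *: << y >> + g)) ->
  forall f, gspan S f -> P f.
Proof.
move=> P0 PS f Sf.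
suff [] : P f /\ gspan S f by [].
have {Sf} : forall y, y \in enum_fset (msupp f) -> S y by exact: Sf.
rewrite [X in P X](monalgE f) [X in gspan S X](monalgE f).
elim: (enum_fset (msupp f)) => [|y s IH] hs.
  by rewrite big_nil; split => //; exact: gspan0.
have [|Pg Sg] := IH; first by move=> z zs; apply: hs; rewrite inE zs orbT.
have Sy : S y by apply: hs; rewrite inE eqxx.
rewrite big_cons; have -> : << f@_y *g y >> = f@_y *: << y >> :> A.
  by apply/malgP => z; rewrite mcoeffZ !mcoeffU; case: eqP; rewrite ?mulr1 ?mulr0.
by split; [exact: PS|apply: gspan_lin => //; exact: gspanU].
Qed.

Lemma malg_ind (P : A -> Prop) : P 0 ->
  (forall k y g, P g -> P (k *: << y >> + g)) -> forall f, P f.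
Proof. by move=> P0 PS f; apply: (@gspan_ind setT) => // k y g _ _; exact: PS. Qed.

Lemma gspan_wact S w f : (forall y, S y -> S (w y)) ->
  gspan S f -> gspan S (wact w f).
Proof.
move=> Sw; move: f; apply: (@gspan_ind S (fun f => gspan S (wact w f))) => [|k y g Sy Sg IH].
  by rewrite linear0; exact: gspan0.
by rewrite linearP /= wactU; apply: gspan_lin => //; apply: gspanU; exact: Sw.
Qed.

Lemma wact_comp (v w : 'End(E)) f : wact v (wact w f) = wact (v \o w)%VF f.
Proof.
elim/malg_ind: f => [|k y f IH]; first by rewrite !linear0.
by rewrite !linearP /= IH !wactU comp_lfunE.
Qed.

Lemma wact1 f : wact \1%VF f = f.
Proof.
elim/malg_ind: f => [|k y f IH]; first by rewrite !linear0.
by rewrite linearP /= IH wactU id_lfunE.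
Qed.

Lemma gmulE f g :
  gmul f g = lin_ext (fun y => lin_ext (fun z => << y + z >> : A) g) f.
Proof. by []. Qed.

Lemma gmulDl f1 f2 g : gmul (f1 + f2) g = gmul f1 g + gmul f2 g.
Proof. by rewrite !gmulE linearD. Qed.

Lemma gmulZl k f g : gmul (k *: f) g = k *: gmul f g.
Proof. by rewrite !gmulE linearZ. Qed.

(** Multiplication by x^v. All products that occur reduce to such translations. *)
Definition shift v : A -> A := lin_ext (fun z => << v + z >> : A).
HB.instance Definition _ v :=
  GRing.Linear.copy (shift v) (lin_ext (fun z => << v + z >> : A)).

Lemma shiftU v z : shift v << z >> = << v + z >> :> A.
Proof. exact: lin_extU. Qed.

Lemma gmulU v f : gmul << v >> f = shift v f.
Proof. by rewrite gmulE lin_extU. Qed.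

Lemma gmulUr f v : gmul f << v >> = shift v f.
Proof.
elim/malg_ind: f => [|k y f IH]; first by rewrite gmulE !linear0.
by rewrite gmulDl gmulZl gmulU IH linearP /= !shiftU (addrC v).
Qed.

Lemma shift_shift u v f : shift u (shift v f) = shift (u + v) f.
Proof.
elim/malg_ind: f => [|k y f IH]; first by rewrite !linear0.
by rewrite !linearP /= IH !shiftU addrA.
Qed.

Lemma shift0 f : shift 0 f = f.
Proof.
elim/malg_ind: f => [|k y f IH]; first by rewrite !linear0.
by rewrite !linearP /= IH !shiftU add0r.
Qed.

Lemma mcoeff_shift v f y : (shift v f)@_y = f@_(y - v).
Proof.
elim/malg_ind: f => [|k z f IH]; first by rewrite linear0 !mcoeff0.
rewrite linearP /= !mcoeffD !mcoeffZ IH shiftU !mcoeffU.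
by rewrite -(inj_eq (addrI (- v)) (v + z)) addKr [- v + y]addrC.
Qed.

Lemma wact_shift w v f : wact w (shift v f) = shift (w v) (wact w f).
Proof.
elim/malg_ind: f => [|k y f IH]; first by rewrite !linear0.
by rewrite !linearP /= IH !(shiftU, wactU) linearD.
Qed.

Lemma gspan_shift S S' v f : (forall y, S y -> S' (v + y)) ->
  gspan S f -> gspan S' (shift v f).
Proof.
move=> h /gspanP Sf; apply/gspanP => y; rewrite mcoeff_shift => /Sf /h.
by rewrite addrC subrK.
Qed.

(* A nonzero [g] would have all [y - n v] in its support. *)
Lemma shift_eigen0 v k1 k2 g : v != 0 -> k2 != 0 ->
  k1 *: shift v g = k2 *: g -> g = 0.
Proof.
move=> v0 k20 e; apply/malgP => y; rewrite mcoeff0; apply/eqP/negPn/negP => gy.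
have hn n : g@_(y - v *+ n) != 0.
  elim: n => [|n]; first by rewrite mulr0n subr0.
  apply: contra_neq => gn; have := congr1 (mcoeff (y - v *+ n)) e.
  rewrite !mcoeffZ mcoeff_shift -addrA -opprD -mulrSr gn mulr0.
  by move/esym/eqP; rewrite mulf_eq0 (negPf k20) => /eqP.
pose s := [seq y - v *+ n | n <- iota 0 (size (msupp g)).+1].
have : uniq s.
  rewrite map_inj_uniq ?iota_uniq // => n m /addrI /oppr_inj.
  rewrite -!(scaler_nat _ v) => /eqP; rewrite -subr_eq0 -scalerBl scaler_eq0.
  by rewrite (negPf v0) orbF subr_eq0 eqr_nat => /eqP.
move=> /uniq_leq_size /(_ (_ : {subset s <= msupp g})) => h.
have : (size s <= size (msupp g))%N.
  by apply: h => _ /mapP[n _ ->]; rewrite -mcoeff_neq0.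
by rewrite size_map size_iota ltnn.
Qed.

(** Multiplication by x^v - 1, which [gdiv] inverts. Its injectivity reduces identities for [nabla]
    to identities without division. *)
Definition diff_op v g : A := shift v g - g.

Lemma diff_opP v k f g : diff_op v (k *: f + g) = k *: diff_op v f + diff_op v g.
Proof. by rewrite /diff_op linearP /= scalerBr opprD addrACA. Qed.

HB.instance Definition _ v :=
  GRing.isLinear.Build F A A _ (diff_op v) (diff_opP v).

Lemma diff_op_inj v : v != 0 -> injective (diff_op v).
Proof.
move=> v0 f g e; apply/subr0_eq; apply: (@shift_eigen0 v 1 1) => //.
  exact: oner_neq0.
by apply/eqP; rewrite !scale1r -subr_eq0 -/(diff_op v (f - g)) linearB /= e subrr.
Qed.

Lemma wact_diff_op w v g : wact w (diff_op v g) = diff_op (w v) (wact w g).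
Proof. by rewrite /diff_op linearB /= wact_shift. Qed.

Lemma shift_diff_op u v g : shift u (diff_op v g) = diff_op v (shift u g).
Proof. by rewrite /diff_op linearB /= !shift_shift (addrC u). Qed.

Lemma diff_opN v g : diff_op (- v) g = - shift (- v) (diff_op v g).
Proof. by rewrite /diff_op linearB /= shift_shift addNr shift0 opprB. Qed.

Lemma gdivE v g : v != 0 -> gdiv (diff_op v g) v = g.
Proof.
move=> v0; have e h : gmul (<< v >> - << 0 >>) h = diff_op v h.
  by rewrite -scaleN1r addrC gmulDl gmulZl !gmulU shift0 scaleN1r addrC.
rewrite /gdiv; case: xgetP => [h _ /=|/(_ g)].
  by rewrite e => /(diff_op_inj v0).
by move=> h; case: h; rewrite /= e.
Qed.

Lemma diff_op_string v y (n : int) : exists2 g : A,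
  diff_op v g = << y - v *~ n >> - << y >> &
  gspan [set z | exists m : int, z = y + v *~ m] g.
Proof.
elim: n => [|n [g e Sg]|n [g e Sg]].
- exists 0; last exact: gspan0.
  by rewrite linear0 mulr0z subr0 subrr.
- exists (g - << y - v *~ n.+1 >>).
    rewrite linearB /= e /diff_op shiftU.
    have -> : v + (y - v *~ n.+1) = y - v *~ n.
      by rewrite intS mulrzDr mulr1z opprD addrCA addNKr.
    by rewrite opprB addrC addrA subrK.
  by apply: gspanB => //; apply: gspanU; exists (- n.+1%:Z); rewrite mulrNz.
- exists (g + << y - v *~ (- n%:Z) >>).
    rewrite linearD /= e /diff_op shiftU.
    have -> : v + (y - v *~ (- n%:Z)) = y - v *~ (- n.+1%:Z).
      by rewrite !mulrNz !opprK intS mulrzDr mulr1z addrCA.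
    by rewrite addrC addrA subrK.
  by apply: gspanD => //; apply: gspanU; exists n%:Z; rewrite mulrNz opprK.
Qed.

(* [comp_at L z f] is the coefficient of [x^z] in the decomposition of [f] over
   the cosets of [L]. *)
Definition comp_at (L : set E) z : A -> A :=
  lin_ext (fun y => if `[< L (y - z) >] then << y - z >> else 0).
HB.instance Definition _ L z := GRing.Linear.copy (comp_at L z)
  (lin_ext (fun y => if `[< L (y - z) >] then << y - z >> else 0 : A)).

Lemma mcoeff_comp_at L z f y :
  (comp_at L z f)@_y = if `[< L y >] then f@_(y + z) else 0.
Proof.
elim/malg_ind: f => [|k x f IH]; first by rewrite linear0 !mcoeff0 if_same.
rewrite linearP /= mcoeffD mcoeffZ IH /comp_at lin_extU.
have [->|ne] := eqVneq x (y + z).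
  rewrite addrK; case: asboolP => _; last by rewrite mcoeff0 mulr0 addr0.
  by rewrite mcoeffD mcoeffZ !mcoeffU !eqxx.
have -> : (if `[< L (x - z) >] then << x - z >> else 0 : A)@_y = 0.
  case: asboolP => _; last by rewrite mcoeff0.
  by rewrite mcoeffU subr_eq (negPf ne).
by rewrite mulr0 add0r mcoeffD mcoeffZ mcoeffU (negPf ne) mulr0 add0r.
Qed.

Lemma gspan_comp_at L z f : gspan L (comp_at L z f).
Proof. by apply/gspanP => y; rewrite mcoeff_comp_at; case: asboolP => //; rewrite eqxx. Qed.

Lemma comp_at_shift L z g : gspan L g -> comp_at L z (shift z g) = g.
Proof.
move=> /gspanP Lg; apply/malgP => y; rewrite mcoeff_comp_at mcoeff_shift addrK.
by case: asboolP => // Ly; apply/esym/eqP/negPn/negP => /Lg.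
Qed.

Lemma comp_at_shift0 L z z' g :
  (forall x y, L x -> L y -> x + z <> y + z') ->
  gspan L g -> comp_at L z (shift z' g) = 0.
Proof.
move=> h /gspanP Lg; apply/malgP => y; rewrite mcoeff_comp_at mcoeff_shift mcoeff0.
case: asboolP => // Ly; apply/eqP/negPn/negP => /Lg Lz.
by apply: (h _ _ Ly Lz); rewrite subrK.
Qed.
End GroupAlgebra.

(** * The quasi-polynomial action on cosets of the lattice *)

Section Lattice.
Variables (R : realType) (E : vectType R) (ip : {dot E for @idfun R}).
Variables (Phi : based_root_system ip) (F : fieldType) (t : dual E -> F).
Variables (L : set E) (L_adm : admissible_lattice Phi L).
Implicit Types (a b : dual E) (w v u : 'End(E)) (s : seq 'I_(rs_rank Phi)).
Implicit Types (i j k : 'I_(rs_rank Phi)) (y c : E) (p f g : {malg F[E]}).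
Local Notation al := (@simple _ _ _ Phi).
Local Notation pos := (pos_root Phi).
Local Notation sr := (@simple_refl _ _ _ Phi).
Local Notation cor := (@simple_coroot _ _ _ Phi).
Local Notation weyl := (weyl Phi).
Local Notation tj := (@tj _ _ _ Phi F t).
Local Notation nabla := (@nabla _ _ _ Phi F).
Local Notation qpT := (@qpT _ _ _ Phi F t).

HB.instance Definition _ j := GRing.isLinear.Build F {malg F[E]} {malg F[E]} _
  (qpT j) (lin_ext_linear _).

Lemma lattice_sub x y : L x -> L y -> L (x - y).
Proof.
have [[m [s ->]] _ _] := L_adm; move=> [p ->] [q ->].
exists [ffun i => p i - q i].
by rewrite -sumrB; apply: eq_bigr => i _; rewrite ffunE mulrzBr.
Qed.

Lemma coroot_in_lattice a : a \in root_seq Phi -> L (coroot ip a).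
Proof.
have [_ sub _] := L_adm; move=> ar; apply: sub.
have cin : coroot ip a \in [seq coroot ip b | b <- root_seq Phi] by exact: map_f.
pose i0 := index (coroot ip a) [seq coroot ip b | b <- root_seq Phi].
have lt0 : (i0 < size [seq coroot ip b | b <- root_seq Phi])%N by rewrite index_mem.
exists [ffun i => if i == Ordinal lt0 then 1 else 0].
rewrite (bigD1 (Ordinal lt0)) //= ffunE eqxx mulr1z nth_index // big1 ?addr0 //.
by move=> i /negPf ni; rewrite ffunE ni mulr0z.
Qed.

Lemma simple_coroot_in_lattice j : L (cor j).
Proof. exact/coroot_in_lattice/simple_roots. Qed.

Lemma lattice0 : L 0.
Proof.
have [[m [s ->]] _ _] := L_adm; exists [ffun=> 0].
by rewrite big1 // => i _; rewrite ffunE mulr0z.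
Qed.

Lemma lattice_opp y : L y -> L (- y).
Proof. by move=> Ly; rewrite -sub0r; apply: lattice_sub => //; exact: lattice0. Qed.

Lemma lattice_add x y : L x -> L y -> L (x + y).
Proof. by move=> Lx /lattice_opp Ly; rewrite -[y]opprK; exact: lattice_sub. Qed.

Lemma lattice_mulz y (n : int) : L y -> L (y *~ n).
Proof.
move=> Ly; elim: n => [|n IH|n IH]; first by rewrite mulr0z; exact: lattice0.
  by rewrite intS mulrzDr mulr1z; exact: lattice_add.
rewrite mulrNz intS mulrzDr mulr1z opprD -mulrNz.
by apply: lattice_add => //; exact: lattice_opp.
Qed.

Lemma simple_int j y : L y -> exists n : int, al j y = n%:~R.
Proof.
have [_ _ h] := L_adm; move=> Ly; apply/intrP; apply: h => //.
exact: simple_roots.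
Qed.

Lemma sr_coroot j y (n : int) : al j y = n%:~R -> sr j y = y - cor j *~ n.
Proof. by move=> e; rewrite /simple_refl reflectionE e scaler_int. Qed.

Lemma lattice_sr j y : L y -> L (sr j y).
Proof.
move=> Ly; have [n /sr_coroot ->] := simple_int j Ly; apply: lattice_sub => //.
exact/lattice_mulz/simple_coroot_in_lattice.
Qed.

Lemma lattice_weyl w y : weyl w -> L y -> L (w y).
Proof.
move=> /weylP[s <-] Ly; elim: s => [|j s IH]; first by rewrite /= id_lfunE.
by rewrite wp_cons comp_lfunE; exact: lattice_sr.
Qed.

Lemma simple_coroot_neq0 j : cor j != 0.
Proof.
apply/eqP => e; have := coroot_self ip (simple_neq0 j).
by rewrite -/(simple_coroot j) e linear0 => /esym/eqP; rewrite pnatr_eq0.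
Qed.

Lemma sr_simple_coroot j : sr j (cor j) = - cor j.
Proof.
rewrite /simple_refl reflectionE coroot_self ?simple_neq0 //.
by rewrite scaler_nat mulr2n opprD addrA subrr add0r.
Qed.

Lemma gspan_sr j f : gspan L f -> gspan L (wact (sr j) f).
Proof. by apply: gspan_wact => y; exact: lattice_sr. Qed.

Lemma sr_wactK j f : wact (sr j) (wact (sr j) f) = f.
Proof. by rewrite wact_comp sr_invol wact1. Qed.

Lemma diff_op_lattice j y (n : int) : L y -> exists2 g : {malg F[E]},
  diff_op (cor j) g = << y - cor j *~ n >> - << y >> & gspan L g.
Proof.
move=> Ly; have [g e /gspanP Sg] := diff_op_string F (cor j) y n.
exists g => //; apply/gspanP => z /Sg[m ->]; apply: lattice_add => //.
exact/lattice_mulz/simple_coroot_in_lattice.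
Qed.

(** The quotient defining [nabla] is a choice. It exists on F[L] because alpha_j is integral on L,
    which makes each monomial's difference telescope, and it is unique because [diff_op] is
    injective. *)
Lemma nablaP j f : gspan L f ->
  diff_op (cor j) (nabla j f) = wact (sr j) f - f /\ gspan L (nabla j f).
Proof.
move=> Lf; suff [g e Lg] : exists2 g, diff_op (cor j) g = wact (sr j) f - f & gspan L g.
  by rewrite /Defs.nabla -e gdivE ?simple_coroot_neq0.
move: f Lf; apply: gspan_ind => [|k y f Ly Lf [g e Lg]].
  by exists 0; [rewrite !linear0 addr0|exact: gspan0].
have [n en] := simple_int j Ly; have [h eh Lh] := diff_op_lattice j n Ly.
exists (k *: h + g); last exact: gspan_lin.
rewrite [LHS]linearP [X in X - _]linearP /= eh e wactU (sr_coroot en) scalerBr opprD.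
by rewrite addrACA.
Qed.

Lemma diff_op_nabla j f : gspan L f ->
  diff_op (cor j) (nabla j f) = wact (sr j) f - f.
Proof. by move=> /(nablaP j)[]. Qed.

Lemma gspan_nabla j f : gspan L f -> gspan L (nabla j f).
Proof. by move=> /(nablaP j)[]. Qed.

Lemma nabla_uniq j f g : gspan L f -> diff_op (cor j) g = wact (sr j) f - f ->
  nabla j f = g.
Proof.
move=> Lf e; apply: (diff_op_inj (simple_coroot_neq0 j)).
by rewrite diff_op_nabla.
Qed.

Lemma nabla_lin j (k : F) f g : gspan L f -> gspan L g ->
  nabla j (k *: f + g) = k *: nabla j f + nabla j g.
Proof.
move=> Lf Lg; apply: nabla_uniq; first exact: gspan_lin.
by rewrite [LHS]linearP [X in X - _]linearP /= !diff_op_nabla // scalerBr opprD addrACA.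
Qed.

Lemma nabla0 j : nabla j 0 = 0.
Proof.
by apply: nabla_uniq; [exact: gspan0|rewrite !linear0 addr0].
Qed.

Lemma sr_nabla j f : gspan L f ->
  wact (sr j) (nabla j f) = nabla j f + wact (sr j) f - f.
Proof.
move=> Lf; apply: (diff_op_inj (simple_coroot_neq0 j)).
have ev : sr j (- cor j) = cor j by rewrite linearN /= sr_simple_coroot opprK.
rewrite -{1}ev -wact_diff_op diff_opN diff_op_nabla // [LHS]linearN /= wact_shift.
rewrite ev [wact _ (_ - _)]linearB /= sr_wactK -[LHS]linearN /= opprB.
rewrite -addrA [RHS]linearD /= diff_op_nabla // /diff_op.
by rewrite addrCA subrr addr0.
Qed.

Lemma nabla_eq0 j f : gspan L f -> nabla j f = 0 <-> wact (sr j) f = f.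
Proof.
move=> Lf; split=> [e|e]; last by apply: nabla_uniq => //; rewrite linear0 e subrr.
by apply/subr0_eq; rewrite -diff_op_nabla // e linear0.
Qed.

Section Coset.
Variables (j : 'I_(rs_rank Phi)) (z : E).
Hypothesis z_alcove : -1 < (al j z : R) < 1.
Let q := tj j - (tj j)^-1.

Lemma chi_coset y : L y -> chi t j (al j (y + z)) = if al j z == 0 then tj j else 1.
Proof.
move=> Ly; have [n en] := simple_int j Ly.
rewrite /chi linearD /= en.
have -> : ((n%:~R + al j z : R) \is a Num.int) = (al j z == 0); last by [].
rewrite rpredDl ?intr_int //; apply/idP/idP => [/intrP[m em]|/eqP ->]; last exact: rpred0.
move: z_alcove; rewrite em => /andP[m1 m2].
have {}m1 : -1 < m by rewrite -(ltr_int R).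
have {}m2 : m < 1 by rewrite -(ltr_int R).
by rewrite (_ : m = 0) //; lia.
Qed.

Lemma qpT_coset p : gspan L p ->
  qpT j (shift z p) =
  if al j z == 0 then shift z (tj j *: wact (sr j) p + q *: nabla j p)
  else shift (sr j z) (wact (sr j) p)
       + q *: shift z (nabla j p + (if al j z < 0 then wact (sr j) p else 0)).
Proof.
move: p; apply: gspan_ind => [|k y p Ly Lp IH].
  by rewrite nabla0 !(linear0, scaler0, addr0, if_same).
have [n en] := simple_int j Ly; have [h eh Lh] := diff_op_lattice j n Ly.
have sy := sr_coroot en.
have nh : nabla j << y >> = h.
  by apply: nabla_uniq; [exact: gspanU|rewrite wactU sy].
have fl : Num.floor (al j (z + y) : R) = n + (if al j z < 0 then -1 else 0).
  apply: floor_def; rewrite linearD /= en.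
  move: z_alcove; case: ifP; rewrite ?intrD; lra.
(* For negative alpha_j(z) the string summed in [h] is prolonged by the single monomial x^(s_j
   y). *)
have gd : gdiv (<< z + y - cor j *~ Num.floor (al j (z + y) : R) >> - << z + y >>) (cor j)
   = shift z (h + (if al j z < 0 then << sr j y >> else 0)) :> {malg F[E]}.
  rewrite -[RHS](gdivE _ (simple_coroot_neq0 j)); congr gdiv.
  rewrite -shift_diff_op [diff_op _ (_ + _)]linearD /= eh -sy fl.
  case: ifP => _; last by rewrite linear0 addr0 addr0 linearB /= !shiftU sy addrA.
  rewrite /diff_op [X in shift z X]addrC addrA subrK [RHS]linearB /= !shiftU.
  congr (<< _ >> - _); rewrite sy mulrzDr mulrN1z opprD opprK -!addrA; congr (z + _).
  by rewrite addrA addrC.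
have -> : qpT j (shift z (k *: << y >> + p)) =
    k *: qpT j << z + y >> + qpT j (shift z p).
  by rewrite [shift _ _]linearP /= shiftU [LHS]linearP.
have -> : qpT j << z + y >> =
    (if al j z == 0 then tj j else 1) *: << sr j (y + z) >>
    + q *: shift z (h + (if al j z < 0 then << sr j y >> else 0)).
  by rewrite /Defs.qpT lin_extU gd [z + y]addrC chi_coset.
have nE : nabla j (k *: << y >> + p) = k *: h + nabla j p.
  by rewrite nabla_lin ?nh //; exact: gspanU.
rewrite IH nE.
have wE : wact (sr j) (k *: << y >> + p) = k *: << sr j y >> + wact (sr j) p.
  by rewrite linearP /= wactU.
rewrite wE.
have [z0|z0] := eqVneq (al j z) 0.
  have /sr_fixP z1 := z0.
  have -> : << sr j (y + z) >> = shift z << sr j y >> :> {malg F[E]}.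
    by rewrite shiftU linearD /= z1 addrC.
  by rewrite z0 ltxx addr0; exact: lincomb_fix.
have -> : << sr j (y + z) >> = shift (sr j z) << sr j y >> :> {malg F[E]}.
  by rewrite shiftU linearD /= addrC.
rewrite scale1r; case: ifP => _; first exact: lincomb_move.
have := lincomb_move (shift (sr j z)) (shift z) k q << sr j y >> h 0 (wact (sr j) p)
  (nabla j p) 0.
by rewrite scaler0 !addr0.
Qed.
End Coset.
End Lattice.

(** * Components over the cosets of the lattice in the orbit of c *)

Section Components.
Variables (R : realType) (E : vectType R) (ip : {dot E for @idfun R}).
Variables (Phi : based_root_system ip) (F : fieldType) (t : dual E -> F).
Variables (L : set E) (L_adm : admissible_lattice Phi L).
Variables (c : E) (c_C0 : C0 Phi L c).
Implicit Types (a b : dual E) (w v u : 'End(E)) (s : seq 'I_(rs_rank Phi)).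
Implicit Types (i j k : 'I_(rs_rank Phi)) (y z : E) (p f g : {malg F[E]}).
Local Notation al := (@simple _ _ _ Phi).
Local Notation pos := (pos_root Phi).
Local Notation sr := (@simple_refl _ _ _ Phi).
Local Notation cor := (@simple_coroot _ _ _ Phi).
Local Notation weyl := (weyl Phi).
Local Notation tj := (@tj _ _ _ Phi F t).
Local Notation nabla := (@nabla _ _ _ Phi F).
Local Notation qpT := (@qpT _ _ _ Phi F t).
Local Notation min_reps := (min_reps Phi c).
Local Notation orbit := (ext_orbit Phi L c).
Local Notation comp u := (@comp_at R E F L (u c)).

Lemma min_reps_weyl u : min_reps u -> weyl u.
Proof. by case. Qed.
Hint Resolve min_reps_weyl : core.

Lemma C0_dom i : 0 <= (al i c : R).
Proof. by have [h _] := c_C0; case/andP: (h _ (simple_pos i)). Qed.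

(** If a(c) = 1, the affine reflection sending y to [coroot ip a + reflection ip a y] fixes c,
    although its translation part is nonzero. *)
Lemma C0_lt1 a : pos a -> (a c : R) < 1.
Proof.
move=> pa; have [h st] := c_C0; have /andP[_ le1] := h _ pa.
rewrite lt_neqAle le1 andbT; apply/eqP => a1.
have ar : a \in root_seq Phi by case: pa.
have : ext_stab Phi L c (coroot ip a, reflection ip a).
  split => /=; first exact: (coroot_in_lattice L_adm).
    by have [s <-] := reflection_word ar.
  by rewrite reflectionE a1 scale1r addrC subrK.
rewrite st => -[/= co0 _]; have := coroot_self ip (root_neq0 ar).
by rewrite co0 linear0 => /esym/eqP; rewrite pnatr_eq0.
Qed.

Lemma simple_orbit_pos u j : pos (al j \o u)%VF -> 0 <= (al j (u c) : R) < 1.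
Proof.
by move=> p; have := C0_lt1 p; have := dom_ge0 C0_dom p; rewrite comp_lfunE => -> ->.
Qed.

Lemma simple_orbit_neg u j : pos (- (al j \o u))%VF -> -1 < (al j (u c) : R) <= 0.
Proof.
move=> p; have h1 := C0_lt1 p; have h2 := dom_ge0 C0_dom p.
by move: h1 h2; rewrite opp_lfunE comp_lfunE ltrNl oppr_ge0 => -> ->.
Qed.

Lemma simple_orbit_alcove u j : weyl u -> -1 < (al j (u c) : R) < 1.
Proof.
move=> wu; case: (simple_comp_pos_or_neg j wu) => [/simple_orbit_pos|/simple_orbit_neg];
  move=> /andP[h1 h2]; apply/andP; split => //.
  by apply: lt_le_trans h1; rewrite ltrN10.
by apply: le_lt_trans h2 _; rewrite ltr01.
Qed.

Lemma simple_orbit_lt0 u j : weyl u -> sr j (u c) <> u c ->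
  al j (u c) < (0 : R) <-> pos (- (al j \o u))%VF.
Proof.
move=> wu nfix; have n0 : al j (u c) != (0 : R) by apply/eqP => /sr_fixP.
case: (simple_comp_pos_or_neg j wu) => p; split => // h.
- by have /andP[] := simple_orbit_pos p; rewrite leNgt h.
- by case: (pos_neg_false p).
- by rewrite lt_neqAle n0; have /andP[] := simple_orbit_neg p.
Qed.

(** The pair of u'^-1 (x - y) and u'^-1 u stabilizes c. By the assumption on c its linear part
    already fixes c, so u c = u' c. *)
Lemma coset_uniq u u' x y : min_reps u -> min_reps u' -> L x -> L y ->
  x + u c = y + u' c -> u = u'.
Proof.
move=> mu mu' Lx Ly e; have [_ st] := c_C0.
have wu := min_reps_weyl mu; have wu' := min_reps_weyl mu'.
have : ext_stab Phi L c (u'^-1%VF (x - y), (u'^-1 \o u)%VF).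
  split => /=.
  - by apply: (lattice_weyl L_adm); [exact: weylV|exact: (lattice_sub L_adm)].
  - by apply: weylM => //; exact: weylV.
  - rewrite comp_lfunE -linearD /= addrAC e addrAC subrr add0r.
    by rewrite -comp_lfunE (weyl_mulVw wu') id_lfunE.
rewrite st => -[/= _ [_ stab]]; apply: (min_reps_uniq C0_dom) => //.
by rewrite -[in RHS]stab -[RHS]comp_lfunE comp_lfunA (weyl_mulwV wu') comp_lfun1l.
Qed.

Lemma comp_coset u u' p : min_reps u -> min_reps u' -> gspan L p ->
  comp u (shift (u' c) p) = if u == u' then p else 0.
Proof.
move=> mu mu' Lp; have [->|/eqP ne] := eqVneq u u'; first exact: comp_at_shift.
apply: comp_at_shift0 => // x y Lx Ly e.
by apply: ne; apply: (coset_uniq mu mu' Lx Ly).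
Qed.

Lemma comp_lin u (k : F) f g : comp u (k *: f + g) = k *: comp u f + comp u g.
Proof. exact: linearP. Qed.

Lemma wact_lin w (k : F) f g : wact w (k *: f + g) = k *: wact w f + wact w g.
Proof. exact: linearP. Qed.

Lemma qpT_lin j (k : F) f g : qpT j (k *: f + g) = k *: qpT j f + qpT j g.
Proof. exact: linearP. Qed.

Lemma shift_monomial y z : shift z << y >> = << y + z >> :> {malg F[E]}.
Proof. by rewrite shiftU addrC. Qed.

Lemma compDZ u (k : F) f g : comp u (f + k *: g) = comp u f + k *: comp u g.
Proof. by rewrite linearD linearZ. Qed.

Lemma orbit_coset y : orbit y -> exists l u, [/\ L l, min_reps u & y = l + u c].
Proof.
move=> [l [w [Ll ww ->]]]; have [u [v [mu [_ vc] e]]] := min_reps_dec c ww.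
by exists l, u; split => //; rewrite e comp_lfunE vc.
Qed.

Lemma coset_orbit u l : weyl u -> L l -> orbit (l + u c).
Proof. by exists l, u. Qed.

Lemma gspan_coset u p : weyl u -> gspan L p -> gspan orbit (shift (u c) p).
Proof.
by move=> wu; apply: gspan_shift => y Ly; rewrite addrC; exact: coset_orbit.
Qed.

Lemma orbit_comp_inj f g : gspan orbit f -> gspan orbit g ->
  (forall u, min_reps u -> comp u f = comp u g) -> f = g.
Proof.
move=> /gspanP of_ /gspanP og h; apply/malgP => y.
have [[l [u [Ll mu ->]]]|no] := pselect (exists l u, [/\ L l, min_reps u & y = l + u c]).
  by have := congr1 (mcoeff l) (h u mu); rewrite !mcoeff_comp_at asboolT.
have z g' : (forall y, g'@_y != 0 -> orbit y) -> g'@_y = 0.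
  by move=> hg; apply/eqP/negPn/negP => /hg/orbit_coset.
by rewrite !z.
Qed.

(** The component of pi^qp(T_j) f at u, namely [qpT_coset] read from the receiving coset. The
    off-diagonal term therefore comes from s_j u. *)
Definition qp_comp j u f : {malg F[E]} :=
  if al j (u c) == 0 then
    tj j *: wact (sr j) (comp u f) + (tj j - (tj j)^-1) *: nabla j (comp u f)
  else wact (sr j) (comp (sr j \o u)%VF f)
       + (tj j - (tj j)^-1) *: (nabla j (comp u f)
           + (if al j (u c) < 0 then wact (sr j) (comp u f) else 0)).

Lemma srK j y : sr j (sr j y) = y.
Proof. by rewrite -comp_lfunE sr_invol id_lfunE. Qed.

(** The coset of u' c contributes only to u' and, when s_j moves u' c, to s_j u'. If s_j fixes one
    of u c and u' c but moves the other, then s_j u and u' differ, so the mixed cases give zero. *)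
Lemma comp_qpT_coset j u u' p : min_reps u -> min_reps u' -> gspan L p ->
  comp u (qpT j (shift (u' c) p)) = qp_comp j u (shift (u' c) p).
Proof.
move=> mu mu' Lp; rewrite (qpT_coset _ L_adm) //; last exact/simple_orbit_alcove/min_reps_weyl.
have Ls : gspan L (wact (sr j) p) by exact: (gspan_sr L_adm).
have Ln : gspan L (nabla j p) by exact: (gspan_nabla L_adm).
have Lif (b : bool) : gspan L (if b then wact (sr j) p else 0) by case: b => //; exact: gspan0.
rewrite /qp_comp (comp_coset mu mu') //.
have s0 : wact (sr j) (0 : {malg F[E]}) = 0 by rewrite linear0.
have [eu|neu] := eqVneq u u'.
  rewrite -eu; case: eqP => u0.
    by rewrite comp_at_shift //; apply: gspanD; apply: gspanZ.
  have nfix : sr j (u c) <> u c by move=> /sr_fixP.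
  have mv := min_reps_move C0_dom mu nfix.
  have nvu : (sr j \o u)%VF != u.
    by apply/eqP => e; apply: nfix; rewrite -[RHS]/(u c) -{2}e comp_lfunE.
  have ec : sr j (u c) = (sr j \o u)%VF c by rewrite comp_lfunE.
  have Ly := gspanD Ln (Lif (al j (u c) < 0)).
  rewrite compDZ ec (comp_coset mu mv Ls) (comp_coset mu mu Ly) (comp_coset mv mu Lp).
  by rewrite eqxx eq_sym (negPf nvu) s0.
rewrite (nabla0 F L_adm) s0 if_same addr0 !scaler0 !addr0.
have [u'0|u'0] := eqVneq (al j (u' c)) 0.
  rewrite (comp_coset mu mu'); last by apply: gspanD; apply: gspanZ.
  rewrite (negPf neu); case: eqP => // u0.
  have nfix : sr j (u c) <> u c by move=> /sr_fixP.
  rewrite (comp_coset (min_reps_move C0_dom mu nfix) mu') //.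
  case: eqP => [e|_]; last by rewrite s0.
  exfalso; apply: nfix; move/sr_fixP: u'0; by rewrite -e comp_lfunE srK => /esym.
have nfix' : sr j (u' c) <> u' c by move=> /sr_fixP /eqP; rewrite (negPf u'0).
have mv' := min_reps_move C0_dom mu' nfix'.
have ec : sr j (u' c) = (sr j \o u')%VF c by rewrite comp_lfunE.
rewrite compDZ ec (comp_coset mu mv') // (comp_coset mu mu') //; last exact: gspanD.
rewrite (negPf neu) scaler0 addr0; have [u0|u0] := eqVneq (al j (u c)) 0.
  case: eqP => // e; exfalso; apply: nfix'.
  move/sr_fixP: u0; by rewrite e comp_lfunE srK => /esym.
have nfix : sr j (u c) <> u c by move=> /sr_fixP /eqP; rewrite (negPf u0).
rewrite (comp_coset (min_reps_move C0_dom mu nfix) mu') //.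
have -> : ((sr j \o u)%VF == u') = (u == (sr j \o u')%VF).
  by apply/eqP/eqP => [<-|->]; rewrite sr_involK.
by case: eqP => // _; rewrite s0.
Qed.

Lemma qp_comp_lin j u (k : F) f g :
  qp_comp j u (k *: f + g) = k *: qp_comp j u f + qp_comp j u g.
Proof.
rewrite /qp_comp !comp_lin.
move: (comp u f) (comp u g) (@gspan_comp_at R E F L (u c) f) (@gspan_comp_at R E F L (u c) g).
move: (comp (sr j \o u)%VF f) (comp (sr j \o u)%VF g) => vf vg uf ug Lf Lg.
rewrite (nabla_lin L_adm) // !wact_lin.
move: (wact _ vf) (wact _ vg) (wact _ uf) (wact _ ug) (nabla j uf) (nabla j ug).
move=> wvf wvg wuf wug nf ng; case: (al j (u c) == 0).
  exact: (lincomb_scale (tj j) k (tj j - (tj j)^-1) wuf wug nf ng).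
have -> : (if al j (u c) < 0 then k *: wuf + wug else 0)
  = k *: (if al j (u c) < 0 then wuf else 0) + (if al j (u c) < 0 then wug else 0).
  by case: ifP => _; rewrite ?scaler0 ?addr0.
exact: lincomb_scale_add.
Qed.

Lemma comp_qpT j u f : min_reps u -> gspan orbit f ->
  comp u (qpT j f) = qp_comp j u f.
Proof.
move=> mu; move: f; apply: gspan_ind => [|k y f oy of_ IH].
  have [u0 st] : qp_comp j u 0 = 0 /\ True.
    split => //; have := qp_comp_lin j u (-1) 0 0.
    by rewrite scaler0 addr0 scaleN1r addNr.
  by rewrite u0 !linear0.
have -> : comp u (qpT j (k *: << y >> + f))
    = k *: comp u (qpT j << y >>) + comp u (qpT j f).
  by rewrite qpT_lin; exact: comp_lin.
have -> : comp u (qpT j << y >>) = qp_comp j u << y >>.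
  have [l [u' [Ll mu' ->]]] := orbit_coset oy.
  have Lx : gspan L (<< l >> : {malg F[E]}) by exact: gspanU.
  by rewrite -shift_monomial; exact: (comp_qpT_coset j mu mu' Lx).
by rewrite IH qp_comp_lin.
Qed.

Lemma gspan_qpT j f : gspan orbit f -> gspan orbit (qpT j f).
Proof.
move: f; apply: gspan_ind => [|k y f oy of_ IH]; first by rewrite linear0; exact: gspan0.
rewrite qpT_lin; apply: gspan_lin; last exact: IH.
have [l [u [Ll mu ->]]] := orbit_coset oy; have wu := min_reps_weyl mu.
have Lx : gspan L (<< l >> : {malg F[E]}) by exact: gspanU.
rewrite -shift_monomial (qpT_coset _ L_adm (simple_orbit_alcove j wu) Lx).
have Ls := gspan_sr L_adm (j := j) Lx.
have Ln := gspan_nabla L_adm (j := j) Lx.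
move: (wact _ _) (nabla _ _) Ls Ln => p p' Lp Lp'.
case: (al j (u c) == 0).
  by apply: gspan_coset => //; apply: gspanD; apply: gspanZ.
apply: gspanD.
  have -> : sr j (u c) = (sr j \o u)%VF c by rewrite comp_lfunE.
  by apply: gspan_coset => //; exact: weylM.
apply: gspanZ; apply: gspan_coset => //; apply: gspanD => //.
by case: (al j (u c) < 0) => //; exact: gspan0.
Qed.

Lemma eps_symmetric_comp eps f : gspan orbit f ->
  eps_symmetric Phi t eps f <->
  forall j u, min_reps u -> qp_comp j u f = (eps%:~R * tj j ^ eps) *: comp u f.
Proof.
move=> of_; split=> [h j u mu|h j].
  by rewrite -comp_qpT // h linearZ.
apply: orbit_comp_inj; [exact: gspan_qpT|exact: gspanZ|].
by move=> u mu; rewrite comp_qpT // h // linearZ.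
Qed.

Section Gamma.
Variable w0 : 'End(E).
Hypothesis w0_longest : longest Phi w0.

(** Every element has a reduced word of length at most [len w0], and there are finitely many such
    words. Finiteness lets the sum over a set in [gamma_qp] be treated as an ordinary sum. *)
Lemma finite_weyl : finite_set weyl.
Proof.
pose h (x : {n : 'I_(len Phi w0).+1 & n.-tuple 'I_(rs_rank Phi)}) :=
  word_prod (tagged x : seq 'I_(rs_rank Phi)).
apply: (@sub_finite_set _ _ (h @` setT)); last exact/finite_image/finite_finset.
move=> w ww; have [_ /(_ w ww) le] := w0_longest.
have lt : (size (redex Phi w) < (len Phi w0).+1)%N by [].
exists (Tagged (fun n : 'I_(len Phi w0).+1 => n.-tuple 'I_(rs_rank Phi))
  (in_tuple (redex Phi w) : (Ordinal lt).-tuple _)) => //.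
by rewrite /h /= wp_redex.
Qed.

Lemma finite_min_reps : finite_set min_reps.
Proof. by apply: sub_finite_set finite_weyl => u []. Qed.

Lemma mcoeff_gamma_sum (g : 'End(E) -> {malg F[E]}) u l :
  (forall w, min_reps w -> gspan L (g w)) -> min_reps u -> L l ->
  (\sum_(w \in min_reps) gmul (g w) << w c >>)@_(l + u c) = (g u)@_l.
Proof.
move=> Lg mu Ll; rewrite fsbig_finite; last exact: finite_min_reps.
have uin : u \in fset_set min_reps.
  by rewrite in_fset_set; [exact: mem_set|exact: finite_min_reps].
rewrite raddf_sum (big_fsetD1 u) //= big1_seq ?addr0.
  by rewrite gmulUr mcoeff_shift addrK.
move=> w /andP[_]; rewrite !inE => /andP[/eqP wu]; rewrite in_fset_set; last exact: finite_min_reps.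
move=> /set_mem mw; rewrite gmulUr mcoeff_shift; apply/eqP/negPn/negP.
have /gspanP Lw := Lg w mw; move=> /Lw Lz; apply: wu.
by apply: (coset_uniq mw mu Lz Ll); rewrite subrK.
Qed.

(** [gamma_qp] is a choice among families constrained only on W^c. Disjointness of the cosets makes
    any such family agree there with the components of f, and the components themselves form one. *)
Lemma gamma_comp f u : gspan orbit f -> min_reps u -> gamma_qp Phi L c f u = comp u f.
Proof.
move=> of_ mu; rewrite /gamma_qp; case: xgetP => [g _ [Lg e]|].
  apply/malgP => l; rewrite mcoeff_comp_at; case: asboolP => Ll.
    by rewrite e mcoeff_gamma_sum.
  by apply/eqP/negPn/negP; have /gspanP Lu := Lg u mu; move=> /Lu.
move=> /(_ (fun u => comp u f)); case; split; first by move=> w _; exact: gspan_comp_at.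
apply: orbit_comp_inj => //.
  rewrite fsbig_finite; last exact: finite_min_reps.
  rewrite big_seq; elim/big_rec: _ => [|w x]; first exact: gspan0.
  rewrite in_fset_set; last exact: finite_min_reps.
  move=> /set_mem mw ox; apply: gspanD => //; rewrite gmulUr.
  by apply: gspan_coset; [exact: min_reps_weyl|exact: gspan_comp_at].
move=> v mv; apply/malgP => l; rewrite !mcoeff_comp_at; case: asboolP => // Ll.
rewrite mcoeff_gamma_sum //; first by rewrite mcoeff_comp_at asboolT.
by move=> w _; exact: gspan_comp_at.
Qed.
End Gamma.

End Components.

(** * From eps-symmetry to the explicit formula *)

Section Core.
Variables (R : realType) (E : vectType R) (ip : {dot E for @idfun R}).
Variables (Phi : based_root_system ip) (F : fieldType) (t : dual E -> F).
Variables (t_neq0 : forall a, a \in root_seq Phi -> t a != 0).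
Variables (t_inv : weyl_invariant Phi t).
Variables (L : set E) (L_adm : admissible_lattice Phi L).
Variables (c : E) (c_dom : forall i, 0 <= (@simple _ _ _ Phi i c : R)).
Variables (w0 w0c v0 : 'End(E)).
Hypothesis w0_longest : longest Phi w0.
Hypothesis w0_dec : w0 = (w0c \o v0)%VF.
Hypothesis w0c_min : min_reps Phi c w0c.
Hypothesis v0_stab : weyl_stab Phi c v0.
Implicit Types (a b : dual E) (w v u : 'End(E)) (s : seq 'I_(rs_rank Phi)).
Implicit Types (i j k : 'I_(rs_rank Phi)) (y z : E) (p f g : {malg F[E]}).
Local Notation al := (@simple _ _ _ Phi).
Local Notation pos := (pos_root Phi).
Local Notation sr := (@simple_refl _ _ _ Phi).
Local Notation wp := (@word_prod _ _ _ Phi).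
Local Notation len := (len Phi).
Local Notation redex := (redex Phi).
Local Notation weyl := (weyl Phi).
Local Notation tj := (@tj _ _ _ Phi F t).
Local Notation min_reps := (min_reps Phi c).

Lemma tj_neq0 j : tj j != 0.
Proof. exact/t_neq0/simple_roots. Qed.

Lemma t_comp a w : a \in root_seq Phi -> weyl w -> t (a \o w)%VF = t a.
Proof.
by move=> ar ww; have := t_inv ar (weylV ww); rewrite (weyl_invK ww).
Qed.

Lemma tj_conj j k u : weyl u -> (al k \o u^-1)%VF = al j -> tj k = tj j.
Proof.
by move=> wu e; rewrite /Defs.tj -e t_comp //; [exact: simple_roots|exact: weylV].
Qed.

Let ww0 : weyl w0 := longest_weyl w0_longest.
Hint Resolve ww0 : core.

Lemma tj_star j k : al k = - (al j \o w0)%VF -> tj k = tj j.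
Proof.
move=> e; rewrite /Defs.tj e.
(* Inserting s_j absorbs the sign into an element of W, so that the invariance of t applies. *)
have -> : - (al j \o w0)%VF = (al j \o (sr j \o w0))%VF.
  by rewrite comp_lfunA comp_reflection_self ?simple_neq0 // comp_lfunNl.
by apply: t_comp; [exact: simple_roots|exact: weylM].
Qed.

(** Origin of the factor t(w_{0,c}): at u = w0c the operator b_(w0 u) is a product over letters in
    J_c, so it acts on a common eigenvector by a scalar. *)
Lemma w0_min_rep : (w0 \o w0c)%VF = v0^-1%VF.
Proof.
have wv0 : weyl v0 by case: v0_stab.
rewrite -[LHS]comp_lfun1r -(weyl_mulwV wv0) -[LHS]comp_lfunA [(w0c \o _)%VF]comp_lfunA.
by rewrite -w0_dec comp_lfunA (longest_invol w0_longest) comp_lfun1l.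
Qed.

Lemma w0c_orbit : w0c c = w0 c.
Proof. by case: v0_stab => _ vc; rewrite w0_dec comp_lfunE vc. Qed.

(** * Solving the coupled equations for an abstract family b *)

Section Operators.
Variables (H : algType F) (pi : H -> {malg F[E]} -> {malg F[E]}).
Hypothesis pi_rep : is_representation (gspan L) pi.
Variable b : 'I_(rs_rank Phi) -> H.
Hypothesis b_reduced : forall s s', wp s = wp s' ->
  size s = len (wp s) -> size s' = len (wp s') ->
  \prod_(x <- s) b x = \prod_(x <- s') b x.
Variable theta : 'End(E).
Hypothesis theta_invol : (theta \o theta = \1)%VF.
Hypothesis theta_L : forall y, L y -> L (theta y).
Variable gam : 'End(E) -> {malg F[E]}.
Hypothesis gam_L : forall u, min_reps u -> gspan L (gam u).
Local Notation th := (wact theta).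
Local Notation B w := (\prod_(x <- redex w) b x).
Let p0 := th (gam w0c).

Lemma rep_gspan h f : gspan L f -> gspan L (pi h f).
Proof. by case: pi_rep => h1 _ _ _ _; exact: h1. Qed.

Lemma rep_linZ h (k : F) f : gspan L f -> pi h (k *: f) = k *: pi h f.
Proof.
case: pi_rep => _ lin _ _ _ Lf.
have L0 : gspan L (0 : {malg F[E]}) by exact: gspan0.
have p00 : pi h 0 = 0.
  by have := lin h (-1) 0 0 L0 L0; rewrite scaler0 addr0 scaleN1r addNr.
by rewrite -[k *: f]addr0 lin // p00 addr0.
Qed.

Lemma rep_mul h h' f : gspan L f -> pi (h * h') f = pi h (pi h' f).
Proof. by case: pi_rep => _ _ _ mul _; exact: mul. Qed.

Lemma rep_one f : gspan L f -> pi 1 f = f.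
Proof. by case: pi_rep => _ _ _ _; exact. Qed.

Lemma th_gspan f : gspan L f -> gspan L (th f).
Proof. exact: gspan_wact. Qed.

Lemma thK f : th (th f) = f.
Proof. by rewrite wact_comp theta_invol wact1. Qed.

Lemma th_scale (k : F) f : th (k *: f) = k *: th f.
Proof. exact: linearZ. Qed.

Lemma th_scale2 (k1 k2 : F) f : th (k1 *: (k2 *: f)) = k1 *: (k2 *: th f).
Proof. by rewrite th_scale; congr (_ *: _); exact: th_scale. Qed.

Lemma B_left k w : weyl w -> pos (al k \o w)%VF -> B (sr k \o w)%VF = b k * B w.
Proof.
move=> ww p; have wk := weylM (weyl_sr k) ww.
transitivity (\prod_(x <- k :: redex w) b x); last by rewrite big_cons.
apply: b_reduced.
- by rewrite wp_cons !wp_redex.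
- by rewrite wp_redex.
- by rewrite wp_cons wp_redex // len_srl_pos.
Qed.

Lemma B_right k w : weyl w -> pos (al k \o w^-1)%VF -> B (w \o sr k)%VF = B w * b k.
Proof.
move=> ww p; have wk := weylM ww (weyl_sr k).
transitivity (\prod_(x <- redex w ++ [:: k]) b x); last by rewrite big_cat big_seq1.
apply: b_reduced.
- by rewrite wp_cat wp1 !wp_redex.
- by rewrite wp_redex.
- by rewrite wp_cat wp1 wp_redex // len_srr_pos // size_cat addn1.
Qed.

Lemma B_rev w : weyl w -> B w^-1%VF = \prod_(x <- rev (redex w)) b x.
Proof.
move=> ww; have wv := weylV ww; apply: b_reduced.
- by rewrite -wp_inv !wp_redex.
- by rewrite wp_redex.
- by rewrite size_rev -wp_inv wp_redex // lenV.
Qed.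

Lemma w0_move j k u : weyl u -> al k = - (al j \o w0)%VF ->
  (sr k \o (w0 \o (sr j \o u)))%VF = (w0 \o u)%VF.
Proof.
move=> wu e; have ek := longest_star_sr w0_longest e.
have -> : (sr k \o (w0 \o (sr j \o u)) = (sr k \o w0) \o (sr j \o u))%VF.
  by rewrite comp_lfunA.
have -> : (sr k \o w0 = w0 \o sr j)%VF.
  rewrite -[LHS]comp_lfun1l -(longest_invol w0_longest) -comp_lfunA.
  rewrite [(w0 \o (sr k \o w0))%VF]comp_lfunA ek -comp_lfunA.
  by rewrite (longest_invol w0_longest) comp_lfun1r.
by rewrite -comp_lfunA sr_involK.
Qed.

(** Left multiplication by w0 reverses length, so the ascent from u to s_j u becomes a descent from
    w0 u to w0 s_j u = s_k w0 u. *)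
Lemma B_w0_left j k u : weyl u -> al k = - (al j \o w0)%VF -> pos (al j \o u)%VF ->
  B (w0 \o u)%VF = b k * B (w0 \o (sr j \o u))%VF.
Proof.
move=> wu e pj; rewrite -(w0_move wu e) B_left //.
  by do 2 apply: weylM => //.
rewrite e comp_lfunNl -comp_lfunA [(w0 \o (w0 \o _))%VF]comp_lfunA (longest_invol w0_longest).
rewrite comp_lfun1l comp_lfunA comp_reflection_self ?simple_neq0 //.
by rewrite comp_lfunNl opprK.
Qed.

Lemma pi_rev_letters s : (forall k, k \in s -> pi (b k) p0 = (tj k)^-1 *: p0) ->
  gspan L p0 ->
  pi (\prod_(x <- rev s) b x) p0 = (\prod_(k <- s) tj k)^-1 *: p0.
Proof.
move=> h Lp; elim: s h => [|k s IH] h.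
  by rewrite !big_nil invr1 scale1r rep_one.
rewrite rev_cons -cats1 big_cat big_seq1 rep_mul // h ?inE ?eqxx // rep_linZ //.
rewrite IH; last by move=> j js; apply: h; rewrite inE js orbT.
by rewrite scalerA big_cons invfM.
Qed.

(** The correspondence between j and k is quantified over as a relation, because [longest_star]
    provides only existence. *)
Definition twisted_system := forall u j k, min_reps u -> al k = - (al j \o w0)%VF ->
  (sr j (u c) = u c -> th (pi (b k) (th (gam u))) = (tj j)^-1 *: gam u) /\
  (sr j (u c) <> u c -> pos (al j \o u)%VF ->
     gam u = th (pi (b k) (th (gam (sr j \o u)%VF)))).

Lemma twisted_systemP : twisted_system <->
  (forall k, sr k c = c -> pi (b k) p0 = (tj k)^-1 *: p0) /\
  (forall w, min_reps w -> gam w = tw Phi t v0 *: th (pi (B (w0 \o w)%VF) p0)).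
Proof.
have Lp0 : gspan L p0 by apply/th_gspan/gam_L.
have [wv0 v0c] := v0_stab.
have tw0 : tw Phi t v0 != 0.
  by rewrite /tw prodf_seq_neq0; apply/allP => k _; exact: tj_neq0.
split=> [sys|[letters formula]].
  have letters k : sr k c = c -> pi (b k) p0 = (tj k)^-1 *: p0.
    move=> kc; have [j ej] := longest_star w0_longest k.
    have ek : al k = - (al j \o w0)%VF.
      by rewrite ej comp_lfunNl opprK -comp_lfunA (longest_invol w0_longest) comp_lfun1r.
    (* The fixed-point equation at w0c applies, because s_j w0c c = s_j w0 c = w0 s_k c = w0c c. *)
    have [h _] := sys w0c j k w0c_min ek.
    rewrite -[LHS]thK h; first by rewrite th_scale (tj_star ek).
    by rewrite w0c_orbit -comp_lfunE -(longest_star_sr w0_longest ek) comp_lfunE kc.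
  split=> // w; have [n] := ubnP (len w0 - len w); elim: n w => // n IH w wn mw.
  have ww : weyl w by case: mw.
  have [->|/eqP ne] := eqVneq w w0c.
    (* The letters of [v0] lie in J_c, so the product contributes t(v0)^-1 and cancels the
       prefactor. *)
    rewrite w0_min_rep B_rev // pi_rev_letters //; last first.
      by move=> k kin; apply: letters; exact: (stab_letters c_dom wv0 v0c kin).
    by rewrite th_scale thK scalerA mulfV // scale1r.
  have [j [nfix pj]] := min_reps_ascent c_dom w0_longest w0_dec w0c_min v0c mw ne.
  have [k ek] := longest_star w0_longest j.
  have [_ /(_ nfix pj) ->] := sys w j k mw ek.
  have mv := min_reps_move c_dom mw nfix.
  have wv : weyl (sr j \o w)%VF by case: mv.
  rewrite IH //; last first.
    by have := w0_longest.2 _ wv; move: wn; rewrite (len_srl_pos ww pj); lia.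
  rewrite th_scale thK rep_linZ; last exact: rep_gspan.
  by rewrite th_scale (B_w0_left ww ek pj) (rep_mul _ _ Lp0).
move=> u j k mu ek; have wu : weyl u by case: mu.
have step : pos (al j \o u)%VF ->
    th (pi (b k) (pi (B (w0 \o (sr j \o u))%VF) p0)) = th (pi (B (w0 \o u)%VF) p0).
  by move=> pj; rewrite (B_w0_left wu ek pj) (rep_mul _ _ Lp0).
split=> [fixj|nfix pj]; last first.
  have mv := min_reps_move c_dom mu nfix.
  rewrite (formula u) // (formula _ mv) th_scale thK rep_linZ; last exact: rep_gspan.
  by rewrite th_scale step.
have [k' k'c ek'] := min_reps_fix c_dom mu fixj.
have pj : pos (al j \o u)%VF.
  by rewrite -ek' -comp_lfunA (weyl_mulVw wu) comp_lfun1r; exact: simple_pos.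
have tk' := tj_conj wu ek'.
have wv : weyl (w0 \o (sr j \o u))%VF by do 2 apply: weylM => //.
have Bk : B (w0 \o u)%VF = B (w0 \o (sr j \o u))%VF * b k'.
  rewrite -B_right //.
    by rewrite -!comp_lfunA -(min_reps_fix_sr wu ek') sr_involK.
  have ws := weylM (weyl_sr j) wu.
  rewrite (weyl_invM ww0 ws) (weyl_invM (weyl_sr j) wu).
  rewrite sr_inv (longest_inv w0_longest) !comp_lfunA ek' comp_reflection_self ?simple_neq0 //.
  by rewrite comp_lfunNl -ek; exact: simple_pos.
(* The letter k', peeled off on the right, becomes the eigenvalue t_j^-1. Applying b_k on the left
   then completes the remaining product to b_(w0 u). *)
have gE : gam u = (tj j)^-1 *: (tw Phi t v0 *: th (pi (B (w0 \o (sr j \o u))%VF) p0)).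
  rewrite formula // Bk rep_mul // letters // rep_linZ // th_scale tk'.
  by rewrite scalerA mulrC -scalerA.
rewrite {1}gE th_scale th_scale thK !rep_linZ; last 2 first.
- exact: rep_gspan.
- by apply: gspanZ; exact: rep_gspan.
rewrite (formula u mu) -(step pj).
exact: th_scale2.
Qed.
End Operators.
End Core.

(** * The conjugated Hecke operators on F[L] *)

Section HeckeOperators.
Variables (R : realType) (E : vectType R) (ip : {dot E for @idfun R}).
Variables (Phi : based_root_system ip) (F : fieldType) (t : dual E -> F).
Variables (t_neq0 : forall a, a \in root_seq Phi -> t a != 0).
Variables (t_inv : weyl_invariant Phi t).
Variables (L : set E) (L_adm : admissible_lattice Phi L).
Implicit Types (a b : dual E) (w v u : 'End(E)) (s : seq 'I_(rs_rank Phi)).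
Implicit Types (i j k : 'I_(rs_rank Phi)) (y z : E) (p f g x : {malg F[E]}).
Local Notation al := (@simple _ _ _ Phi).
Local Notation pos := (pos_root Phi).
Local Notation sr := (@simple_refl _ _ _ Phi).
Local Notation cor := (@simple_coroot _ _ _ Phi).
Local Notation wp := (@word_prod _ _ _ Phi).
Local Notation len := (len Phi).
Local Notation redex := (redex Phi).
Local Notation weyl := (weyl Phi).
Local Notation tj := (@tj _ _ _ Phi F t).
Local Notation nabla := (@nabla _ _ _ Phi F).

Lemma wactB w f g : wact w (f - g) = wact w f - wact w g.
Proof. exact: linearB. Qed.

Lemma wactN w f : wact w (- f) = - wact w f.
Proof. exact: linearN. Qed.

Lemma wactZ w (k : F) f : wact w (k *: f) = k *: wact w f.
Proof. exact: linearZ. Qed.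

Lemma nabla_sr j x : gspan L x -> nabla j (wact (sr j) x) = - nabla j x.
Proof.
move=> Lx; apply: (nabla_uniq L_adm); first exact: (gspan_sr L_adm).
by rewrite linearN /= (diff_op_nabla L_adm) // sr_wactK opprB.
Qed.

Lemma nabla_nabla j x : gspan L x -> nabla j (nabla j x) = nabla j x.
Proof.
move=> Lx; apply: (nabla_uniq L_adm); first exact: (gspan_nabla L_adm).
rewrite (sr_nabla L_adm) // (diff_op_nabla L_adm) //.
by move: (nabla j x) (wact (sr j) x) => n sx; rewrite -(addrA n) (addrC n) addrK.
Qed.

(* For [kappa] either eigenvalue of [T_j], [T_j^{-1}] or [- T_j] conjugated
   through the longest element becomes this operator. *)
Definition twist_op (kappa : F) j x : {malg F[E]} :=
  (kappa - (tj j - (tj j)^-1)) *: wact (sr j) x - (tj j - (tj j)^-1) *: nabla j x.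

(** The right-hand side is the equation at the end of the pair u, s_j u where alpha_j is negative.
    Applying s_j and the formula for s_j nabla_j solves it for g, the component at the other end. *)
Lemma twist_opP kappa j g x : gspan L x ->
  g = twist_op kappa j x <->
  wact (sr j) g + (tj j - (tj j)^-1) *: (nabla j x + wact (sr j) x) = kappa *: x.
Proof.
move=> Lx; rewrite /twist_op; set q := tj j - _.
have sn := sr_nabla L_adm j Lx; have ss := sr_wactK j x.
split=> [->|e].
  rewrite wactB !wactZ sn ss.
  move: (nabla j x) (wact (sr j) x) => n sx; clearbody q.
  apply/malgP => y; rewrite !(mcoeffD, mcoeffZ, mcoeffN).
  by move: (n@_y) (sx@_y) (x@_y) => *; ring.
have e2 : wact (sr j) g = kappa *: x - q *: (nabla j x + wact (sr j) x).
  by rewrite -e addrK.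
rewrite -[LHS](sr_wactK j) e2 wactB !wactZ linearD /= sn ss.
move: (nabla j x) (wact (sr j) x) => n sx; clearbody q.
apply/malgP => y; rewrite !(mcoeffD, mcoeffZ, mcoeffN).
by move: (n@_y) (sx@_y) (x@_y) => *; ring.
Qed.

(** The equation at the end where alpha_j is positive: it follows from the coupling because kappa is
    a root of the quadratic relation. *)
Lemma twist_op_quadratic kappa j x : kappa * (kappa - (tj j - (tj j)^-1)) = 1 ->
  gspan L x ->
  wact (sr j) x + (tj j - (tj j)^-1) *: nabla j (twist_op kappa j x)
  = kappa *: twist_op kappa j x.
Proof.
move=> k1 Lx; rewrite /twist_op; move: k1; set q := tj j - _ => k1.
have Ls : gspan L (wact (sr j) x) by exact: (gspan_sr L_adm).
have Ln : gspan L (nabla j x) by exact: (gspan_nabla L_adm).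
rewrite -scaleNr (nabla_lin L_adm) //; last exact: gspanZ.
have -> : nabla j (- q *: nabla j x) = - q *: nabla j x.
  have L0 : gspan L (0 : {malg F[E]}) by exact: gspan0.
  have := nabla_lin L_adm j (- q) Ln L0.
  by rewrite (nabla0 F L_adm) !addr0 nabla_nabla.
rewrite nabla_sr //.
move: (nabla j x) (wact (sr j) x) => n sx; clearbody q.
apply/malgP => y; rewrite !(mcoeffD, mcoeffZ, mcoeffN).
move: (n@_y) (sx@_y) => a b.
rewrite [RHS](_ : _ = kappa * (kappa - q) * b - kappa * q * a); last by ring.
by rewrite k1; ring.
Qed.

(** Write n = nabla_j x, v = [simple_coroot j] and substitute s_j x = x + (x^v - 1) n. The two
    equations become t_j x^v n = t_j^-1 n and t_j^-1 x^v n = t_j n. By [shift_eigen0] each forces n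
    = 0, and then both hold. *)
Lemma eigen_sym j x : gspan L x -> tj j != 0 ->
  tj j *: wact (sr j) x + (tj j - (tj j)^-1) *: nabla j x = tj j *: x <->
  twist_op (tj j) j x = (tj j)^-1 *: x.
Proof.
move=> Lx t0; rewrite /twist_op.
have c0 := simple_coroot_neq0 j.
have ti0 : (tj j)^-1 != 0 by rewrite invr_eq0.
have e := diff_op_nabla L_adm j Lx.
have [n0|n0] := eqVneq (nabla j x) 0.
  have /(nabla_eq0 L_adm j Lx) -> := n0.
  rewrite n0 !scaler0 addr0 subr0; split=> // _; congr (_ *: _).
  by rewrite opprB addrC subrK.
split=> h; exfalso; move/eqP: n0; apply.
  apply: (@shift_eigen0 _ _ _ (cor j) (tj j) (tj j)^-1) => //.
  have : shift (cor j) (nabla j x) = wact (sr j) x - x + nabla j x by rewrite -e subrK.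
  move: h => + ->.
  move: (nabla j x) (wact (sr j) x) (tj j) (tj j)^-1 => n sx T Ti /malgP h.
  apply/malgP => y; have := h y; rewrite !(mcoeffD, mcoeffZ, mcoeffN).
  move: (n@_y) (sx@_y) (x@_y) => a b d h'.
  apply/subr0_eq; rewrite -[RHS](subrr (T * d)) -{1}h'; ring.
apply: (@shift_eigen0 _ _ _ (cor j) (tj j)^-1 (tj j)) => //.
have : shift (cor j) (nabla j x) = wact (sr j) x - x + nabla j x by rewrite -e subrK.
move: h => + ->.
move: (nabla j x) (wact (sr j) x) (tj j) (tj j)^-1 => n sx T Ti /malgP h.
apply/malgP => y; have := h y; rewrite !(mcoeffD, mcoeffZ, mcoeffN).
move: (n@_y) (sx@_y) (x@_y) => a b d h'.
apply/subr0_eq; rewrite -[RHS](subrr (Ti * d)) -{1}h'; ring.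
Qed.

(** For this kappa the coefficient kappa - (t_j - t_j^-1) equals - t_j, so [twist_op] is the
    negative of the operator on the left. *)
Lemma eigen_anti j x :
  tj j *: wact (sr j) x + (tj j - (tj j)^-1) *: nabla j x = (- (tj j)^-1) *: x <->
  twist_op (- (tj j)^-1) j x = (tj j)^-1 *: x.
Proof.
rewrite /twist_op.
have -> : - (tj j)^-1 - (tj j - (tj j)^-1) = - tj j by ring.
rewrite !scaleNr -opprD; split=> [->|/(congr1 -%R)]; first by rewrite opprK.
by rewrite opprK.
Qed.

Section Conjugation.
Variables (theta : 'End(E)) (j k : 'I_(rs_rank Phi)).
Hypothesis theta_invol : (theta \o theta = \1)%VF.
Hypothesis theta_L : forall y, L y -> L (theta y).
Hypothesis theta_sr : (theta \o sr k = sr j \o theta)%VF.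
Local Notation th := (wact theta).

Lemma theta_wactK f : th (th f) = f.
Proof. by rewrite wact_comp theta_invol wact1. Qed.

Lemma theta_sr_conj f : th (wact (sr k) (th f)) = wact (sr j) f.
Proof.
by rewrite !wact_comp theta_sr -comp_lfunA theta_invol comp_lfun1r.
Qed.

Lemma theta_nabla f : theta (cor k) = cor j -> gspan L f ->
  th (nabla k (th f)) = nabla j f.
Proof.
move=> tc Lf; have Lt : gspan L (th f) by exact: gspan_wact.
apply/esym/(nabla_uniq L_adm) => //.
rewrite -tc -wact_diff_op (diff_op_nabla L_adm) // wactB.
by rewrite theta_sr_conj theta_wactK.
Qed.

(** The case theta = w0, which reverses simple coroots. The extra terms come from x^(-v) - 1 = -
    x^(-v) (x^v - 1). *)
Lemma theta_nablaN f : theta (cor k) = - cor j -> gspan L f ->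
  th (nabla k (th f)) = f - nabla j f - wact (sr j) f.
Proof.
move=> tc Lf; have Lt : gspan L (th f) by exact: gspan_wact.
apply: (diff_op_inj (simple_coroot_neq0 j)).
have ej : cor j = theta (- cor k) by rewrite linearN /= tc opprK.
rewrite [in LHS]ej -wact_diff_op diff_opN (diff_op_nabla L_adm) //.
have -> : th (- shift (- cor k) (wact (sr k) (th f) - th f))
    = - th (shift (- cor k) (wact (sr k) (th f) - th f)) by exact: linearN.
rewrite wact_shift -ej wactB theta_sr_conj theta_wactK.
have -> : f - nabla j f - wact (sr j) f = (f - wact (sr j) f) - nabla j f.
  by rewrite addrAC.
rewrite [RHS]linearB /= (diff_op_nabla L_adm) //.
rewrite -[f - wact (sr j) f]opprB; move: (wact (sr j) f - f) => d.
by rewrite /diff_op [shift _ (- d)]linearN /= opprK addrK.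
Qed.
End Conjugation.
End HeckeOperators.

(** * Componentwise eps-symmetry as a twisted system *)

Section Systems.
Variables (R : realType) (E : vectType R) (ip : {dot E for @idfun R}).
Variables (Phi : based_root_system ip) (F : fieldType) (t : dual E -> F).
Variables (L : set E) (L_adm : admissible_lattice Phi L).
Variables (c : E) (c_C0 : C0 Phi L c).
Variable w0 : 'End(E).
Hypothesis w0_longest : longest Phi w0.
Implicit Types (a b : dual E) (w v u : 'End(E)) (s : seq 'I_(rs_rank Phi)).
Implicit Types (i j k : 'I_(rs_rank Phi)) (y z : E) (p f g x : {malg F[E]}).
Local Notation al := (@simple _ _ _ Phi).
Local Notation pos := (pos_root Phi).
Local Notation sr := (@simple_refl _ _ _ Phi).
Local Notation weyl := (weyl Phi).
Local Notation tj := (@tj _ _ _ Phi F t).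
Local Notation nabla := (@nabla _ _ _ Phi F).
Local Notation comp u := (@comp_at R E F L (u c)).
Variables (H : algType F) (pi : H -> {malg F[E]} -> {malg F[E]}).
Variable b : 'I_(rs_rank Phi) -> H.
Variable theta : 'End(E).
Variable kappa : 'I_(rs_rank Phi) -> F.
Hypothesis kappa_quad : forall j, kappa j * (kappa j - (tj j - (tj j)^-1)) = 1.
Hypothesis twistE : forall j k x, al k = - (al j \o w0)%VF -> gspan L x ->
  wact theta (pi (b k) (wact theta x)) = twist_op t (kappa j) j x.
Hypothesis eigenP : forall j x, gspan L x ->
  tj j *: wact (sr j) x + (tj j - (tj j)^-1) *: nabla j x = kappa j *: x <->
  twist_op t (kappa j) j x = (tj j)^-1 *: x.

Lemma qp_comp_twisted f :
  (forall j u, min_reps Phi c u -> qp_comp t L c j u f = kappa j *: comp u f) <->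
  twisted_system t c w0 pi b theta (fun u => comp u f).
Proof.
have Lc u : gspan L (comp u f) by exact: gspan_comp_at.
have c_dom := C0_dom c_C0.
split=> [h u j k mu ek|h j u mu]; have wu : weyl u by case: mu.
  split=> /= [fixj|nfix pj].
    rewrite (twistE ek (Lc u)); apply/eigenP; first exact: Lc.
    by rewrite -(h j u mu) /qp_comp; move/sr_fixP: fixj => ->; rewrite eqxx.
  have mv := min_reps_move c_dom mu nfix; have wv : weyl (sr j \o u)%VF by case: mv.
  rewrite (twistE ek (Lc _)); apply/(twist_opP t L_adm); first exact: Lc.
  (* The equation at s_j u is the useful one: there alpha_j is negative, and the component at u
     enters only through its image under s_j. *)
  rewrite -(h j _ mv) /qp_comp.
  have nfixv : sr j ((sr j \o u)%VF c) <> (sr j \o u)%VF c.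
    by rewrite comp_lfunE srK => /esym.
  have -> : (al j ((sr j \o u)%VF c) == 0) = false by apply/eqP => /sr_fixP.
  have -> : al j ((sr j \o u)%VF c) < 0.
    apply/(simple_orbit_lt0 L_adm c_C0 wv nfixv).
    by rewrite comp_lfunA comp_reflection_self ?simple_neq0 // comp_lfunNl opprK.
  by rewrite sr_involK.
have [k ek] := longest_star w0_longest j.
rewrite /qp_comp; have [u0|u0] := eqVneq (al j (u c)) 0.
  have [/= hk _] := h u j k mu ek; apply/eigenP; first exact: Lc.
  by rewrite -(twistE ek (Lc u)); apply: hk; apply/sr_fixP.
have nfix : sr j (u c) <> u c by move=> /sr_fixP/eqP; rewrite (negPf u0).
have mv := min_reps_move c_dom mu nfix; have wv : weyl (sr j \o u)%VF by case: mv.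
case: (simple_comp_pos_or_neg j wu) => pj.
  have [_ /(_ nfix pj) /=] := h u j k mu ek; rewrite (twistE ek (Lc _)) => e.
  have -> : (al j (u c) < 0) = false.
    by apply/negbTE; rewrite -leNgt; have /andP[] := simple_orbit_pos L_adm c_C0 pj.
  by rewrite addr0 e; exact: (twist_op_quadratic L_adm).
have -> : al j (u c) < 0 by apply/(simple_orbit_lt0 L_adm c_C0 wu nfix).
apply/(twist_opP t L_adm); first exact: Lc.
have [_ /=] := h (sr j \o u)%VF j k mv ek.
rewrite sr_involK (twistE ek (Lc u)); apply.
  by rewrite comp_lfunE srK => /esym.
by rewrite comp_lfunA comp_reflection_self ?simple_neq0 // comp_lfunNl.
Qed.
End Systems.

(** * Inverses and reduced products in the Hecke algebra *)

Section Generators.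
Variables (R : realType) (E : vectType R) (ip : {dot E for @idfun R}).
Variables (Phi : based_root_system ip) (F : fieldType) (t : dual E -> F).
Variables (t_neq0 : forall a, a \in root_seq Phi -> t a != 0).
Variables (L : set E) (H : unitAlgType F) (T : 'I_(rs_rank Phi) -> H) (X : E -> H).
Hypothesis rel : hecke_relations t L T X.
Implicit Types (w v u : 'End(E)) (s : seq 'I_(rs_rank Phi)).
Local Notation wp := (@word_prod _ _ _ Phi).
Local Notation tj := (@tj _ _ _ Phi F t).

Lemma hecke_quad k : T k * (T k - (tj k - (tj k)^-1)%:A) = 1.
Proof.
have [_ quad _ _ _] := rel; have tk : tj k * (tj k)^-1 = 1.
  by rewrite mulfV // t_neq0 // simple_roots.
have := quad k; rewrite mulrBl !mulrDr -!scalerAl -!scalerAr !mul1r !mulr1.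
rewrite scalerA tk scale1r => /eqP; rewrite subr_eq0 => /eqP e.
rewrite mulrN -scalerAr mulr1 scalerBl opprB addrA e.
by rewrite addrAC subrr add0r.
Qed.

Lemma hecke_unit k : T k \is a GRing.unit.
Proof.
apply/unitrP; exists (T k - (tj k - (tj k)^-1)%:A); split; last exact: hecke_quad.
rewrite -[RHS](hecke_quad k) mulrBl mulrBr; congr (_ - _).
by rewrite -scalerAl -scalerAr mul1r mulr1.
Qed.

Lemma hecke_inv k : (T k)^-1 = T k - (tj k - (tj k)^-1)%:A.
Proof.
by apply: (mulrI (hecke_unit k)); rewrite hecke_quad mulrV ?hecke_unit.
Qed.

Lemma hecke_prod_unit s : \prod_(x <- s) T x \is a GRing.unit.
Proof. by apply: rpred_prod => k _; exact: hecke_unit. Qed.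

Lemma hecke_prod_inv s :
  \prod_(x <- s) (T x)^-1 = (\prod_(x <- rev s) T x)^-1.
Proof.
elim: s => [|k s IH]; first by rewrite !big_nil invr1.
rewrite big_cons IH rev_cons -cats1 big_cat big_seq1.
by rewrite invrM // ?hecke_prod_unit ?hecke_unit.
Qed.

Lemma hecke_prod_opp s :
  \prod_(x <- s) (- T x) = (-1) ^+ size s *: \prod_(x <- s) T x.
Proof.
elim: s => [|k s IH]; first by rewrite !big_nil scale1r.
by rewrite !big_cons IH [size _]/= exprS -scalerA scaleN1r -scalerAr mulNr scalerN.
Qed.

Lemma hecke_reduced s s' : wp s = wp s' -> size s = len Phi (wp s) ->
  size s' = len Phi (wp s') -> \prod_(x <- s) T x = \prod_(x <- s') T x.
Proof.
apply: matsumoto => i j m ij co; rewrite -!alt_prodE.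
by have [braid _ _ _ _] := rel; exact: braid.
Qed.

Lemma reduced_rev s : size s = len Phi (wp s) -> size (rev s) = len Phi (wp (rev s)).
Proof. by rewrite size_rev -wp_inv lenV // => ->. Qed.

Lemma hecke_inv_reduced s s' : wp s = wp s' -> size s = len Phi (wp s) ->
  size s' = len Phi (wp s') -> \prod_(x <- s) (T x)^-1 = \prod_(x <- s') (T x)^-1.
Proof.
move=> e rs rs'; rewrite !hecke_prod_inv; congr (_^-1).
by apply: hecke_reduced; [rewrite -!wp_inv e|exact: reduced_rev..].
Qed.

Lemma hecke_opp_reduced s s' : wp s = wp s' -> size s = len Phi (wp s) ->
  size s' = len Phi (wp s') -> \prod_(x <- s) (- T x) = \prod_(x <- s') (- T x).
Proof.
move=> e rs rs'; rewrite !hecke_prod_opp (hecke_reduced e rs rs').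
by rewrite rs rs' e.
Qed.

(** Both inversions reverse the order of the factors. The operator in the formula for eps = 1 is
    thus the product of the T_k^-1 along a reduced word of w itself, the form in which b is used. *)
Lemma Tw_inv w : weyl Phi w ->
  (Tw T w^-1%VF)^-1 = \prod_(x <- redex Phi w) (T x)^-1.
Proof.
by move=> ww; rewrite hecke_prod_inv /Tw (B_rev hecke_reduced).
Qed.

End Generators.

Section Representation.
Variables (R : realType) (E : vectType R) (F : fieldType) (H : algType F).
Variables (M : set {malg F[E]}) (pi : H -> {malg F[E]} -> {malg F[E]}).
Hypothesis pi_rep : is_representation M pi.

Lemma rep_scale (k : F) h f : M f -> pi (k *: h) f = k *: pi h f.
Proof.
case: pi_rep => _ _ lin _ _ Mf.
have p0 : pi 0 f = 0.
  by have := lin 0 0 (-1) f Mf; rewrite scaler0 addr0 scaleN1r addNr.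
by rewrite -[k *: h]addr0 lin // p0 addr0.
Qed.

Lemma rep_opp h f : M f -> pi (- h) f = - pi h f.
Proof. by move=> Mf; rewrite -scaleN1r rep_scale // scaleN1r. Qed.

Lemma rep_sub_scalar h (k : F) f : M f -> pi (h - k%:A) f = pi h f - k *: f.
Proof.
case: pi_rep => _ _ lin _ one Mf.
by rewrite addrC -scaleNr lin // one // addrC scaleNr.
Qed.

End Representation.

Lemma rep_inv_eigen (R : realType) (E : vectType R) (F : fieldType) (H : algType F)
    (L : set E) (pi : H -> {malg F[E]} -> {malg F[E]}) (h h' : H) (k : F) f :
  is_representation (gspan L) pi -> h' * h = 1 -> k != 0 -> gspan L f ->
  pi h f = k *: f -> pi h' f = k^-1 *: f.
Proof.
move=> rep hh k0 Lf e.
have e1 : pi h' (k *: f) = f by rewrite -e -(rep_mul rep) // hh (rep_one rep).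
by rewrite -[in RHS]e1 (rep_linZ rep) // scalerA mulVf // scale1r.
Qed.

Section OppositeLongest.
Variables (R : realType) (E : vectType R) (F : fieldType).
Implicit Types (w : 'End(E)) (f : {malg F[E]}).

Lemma xinvE f : xinv f = wact (- \1)%VF f.
Proof.
rewrite /xinv /wact; congr (lin_ext _ f); apply/funext => y.
by rewrite opp_lfunE id_lfunE.
Qed.

(** Merges iota and w0 into the single linear map - w0, which can then serve as theta. *)
Lemma xinv_wact w f : xinv (wact w f) = wact (- w) f.
Proof. by rewrite xinvE wact_comp comp_lfunNl comp_lfun1l. Qed.
End OppositeLongest.

Theorem theorem7p3
  (R : realType) (E : vectType R) (ip : {dot E for @idfun R})
  (Phi : based_root_system ip)
  (F : fieldType) (t : dual E -> F)
  (t_neq0 : forall a, a \in root_seq Phi -> t a != 0)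
  (t_inv : weyl_invariant Phi t)
  (L : set E) (L_adm : admissible_lattice Phi L)
  (H : unitAlgType F) (T : 'I_(rs_rank Phi) -> H) (X : E -> H)
  (H_hecke : is_affine_hecke t L T X)
  (pi : H -> {malg F[E]} -> {malg F[E]})
  (pi_poly : is_poly_rep t L T X pi)
  (c : E) (c_C0 : C0 Phi L c)
  (f : {malg F[E]}) (f_orbit : gspan (ext_orbit Phi L c) f)
  (eps : int) (eps_pm1 : eps = 1 \/ eps = -1)
  (w0 w0c w0_c : 'End(E))
  (w0_longest : longest Phi w0)
  (w0_dec : w0 = (w0c \o w0_c)%VF)
  (w0c_min : min_reps Phi c w0c) (w0_c_stab : weyl_stab Phi c w0_c) :
  let gamma := gamma_qp Phi L c f in
  eps_symmetric Phi t eps f <->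
  (if eps == 1 then
     part_symmetric t L T pi (Jset c) (wact w0 (gamma w0c))
   else
     part_antisymmetric t L T pi (Jset c) (xinv (wact w0 (gamma w0c))))
  /\
  (forall w, min_reps Phi c w ->
     gamma w =
     if eps == 1 then
       tw Phi t w0_c *:
         wact w0 (pi (Tw T ((w0 \o w)^-1)%VF)^-1 (wact w0 (gamma w0c)))
     else
       (tw Phi t w0_c * (-1) ^+ (len Phi w0 + len Phi w)) *:
         xinv (wact w0 (pi (Tw T (w0 \o w)%VF) (xinv (wact w0 (gamma w0c)))))).
Proof.
move=> gamma.
have [rel _] := H_hecke; have [pi_rep piT _] := pi_poly.
have w0w := longest_weyl w0_longest; have w0K := longest_invol w0_longest.
have c_dom := C0_dom c_C0.
have t0 j : tj (Phi := Phi) t j != 0 by exact: tj_neq0.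
pose g u := comp_at L (u c) f.
have gL u : min_reps Phi c u -> gspan L (g u) by move=> _; exact: gspan_comp_at.
have gE u : min_reps Phi c u -> gamma u = g u.
  exact: (gamma_comp L_adm c_C0 w0_longest f_orbit).
have w0L y : L y -> L (w0 y) by exact: (lattice_weyl L_adm w0w).
apply: iff_trans (eps_symmetric_comp t L_adm c_C0 eps f_orbit) _.
rewrite (gE _ w0c_min).
case: eps_pm1 => ->.
  rewrite eqxx.
  pose b k := (T k)^-1; pose kappa j := 1%:~R * tj (Phi := Phi) t j ^ (1 : int).
  have kE j : kappa j = tj t j by rewrite /kappa mul1r expr1z.
  have quad j : kappa j * (kappa j - (tj t j - (tj t j)^-1)) = 1.
    by rewrite kE opprB addrC subrK mulfV.
  have twistE j k x : simple k = - (simple j \o w0)%VF -> gspan L x ->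
      wact w0 (pi (b k) (wact w0 x)) = twist_op t (kappa j) j x.
    move=> ek Lx; have Lw : gspan L (wact w0 x) by exact: gspan_wact.
    have cs := theta_sr_conj w0K (longest_star_sr w0_longest ek) x.
    have cn := theta_nablaN L_adm w0K w0L (longest_star_sr w0_longest ek)
      (longest_star_coroot w0_longest ek) Lx.
    rewrite [b k](hecke_inv t_neq0 rel k) (rep_sub_scalar pi_rep _ _ Lw) (piT k _ Lw) kE.
    rewrite wactB wact_lin !wactZ cs cn (theta_wactK w0K) /twist_op.
    rewrite (tj_star t_inv w0_longest ek).
    move: (nabla j x) (wact _ x) (tj t j) (tj t j)^-1 => n sx a ai.
    apply/malgP => y; rewrite !(mcoeffD, mcoeffZ, mcoeffN).
    by move: (n@_y) (sx@_y) (x@_y) => *; ring.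
  have eigenP j x : gspan L x ->
      tj t j *: wact (simple_refl j) x + (tj t j - (tj t j)^-1) *: nabla j x
        = kappa j *: x <->
      twist_op t (kappa j) j x = (tj t j)^-1 *: x.
    by move=> Lx; rewrite kE; exact: (eigen_sym L_adm).
  apply: iff_trans (qp_comp_twisted L_adm c_C0 w0_longest quad twistE eigenP f) _.
  apply: iff_trans (twisted_systemP t_neq0 t_inv c_dom w0_longest w0_dec w0c_min
    w0_c_stab pi_rep (hecke_inv_reduced t_neq0 rel) w0K w0L gL) _.
  have Lp : gspan L (wact w0 (g w0c)) by exact: (gspan_wact w0L (gL _ w0c_min)).
  split=> -[h1 h2]; split.
  (* The eigenvector condition concerns T_k^-1 with eigenvalue t_k^-1; inverting both gives partial
     symmetry. *)
  - split=> // k kc; rewrite -[tj t k]invrK.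
    apply: (rep_inv_eigen pi_rep _ _ Lp (h1 k kc)); last by rewrite invr_eq0.
    by rewrite mulrV // (hecke_unit t_neq0 rel).
  - move=> w mw; rewrite (gE _ mw) (h2 _ mw); have ww : weyl Phi w by case: mw.
    by rewrite (Tw_inv t_neq0 rel) //; exact: weylM.
  - move=> k kc; have [_ /(_ k kc) e] := h1.
    apply: (rep_inv_eigen pi_rep _ _ Lp e) => //.
    by rewrite mulVr // (hecke_unit t_neq0 rel).
  - move=> w mw; rewrite -(gE _ mw) (h2 _ mw); have ww : weyl Phi w by case: mw.
    by rewrite (Tw_inv t_neq0 rel) //; exact: weylM.
rewrite (_ : (-1 == 1 :> int) = false) // !xinv_wact.
pose b k := - T k; pose kappa j := (-1)%:~R * tj (Phi := Phi) t j ^ (-1 : int).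
have kE j : kappa j = - (tj t j)^-1 by rewrite /kappa mulN1r.
have quad j : kappa j * (kappa j - (tj t j - (tj t j)^-1)) = 1.
  rewrite kE (_ : - (tj t j)^-1 - _ = - tj t j); last by ring.
  by rewrite mulrNN mulVf.
have mK : (- w0 \o - w0)%VF = \1%VF.
  by rewrite comp_lfunNl comp_lfunNr opprK.
have mL y : L y -> L ((- w0)%VF y).
  by move=> Ly; rewrite opp_lfunE; apply/(lattice_opp L_adm)/w0L.
have mS (j k : 'I_(rs_rank Phi)) : simple k = - (simple j \o w0)%VF ->
    (- w0 \o simple_refl (Phi := Phi) k = simple_refl j \o - w0)%VF.
  by move=> ek; rewrite comp_lfunNl comp_lfunNr (longest_star_sr w0_longest ek).
have twistE j k x : simple k = - (simple j \o w0)%VF -> gspan L x ->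
    wact (- w0)%VF (pi (b k) (wact (- w0)%VF x)) = twist_op t (kappa j) j x.
  move=> ek Lx; have Lw : gspan L (wact (- w0)%VF x) by exact: gspan_wact.
  have cs := theta_sr_conj mK (mS j k ek) x.
  have cn : wact (- w0)%VF (nabla k (wact (- w0)%VF x)) = nabla j x.
    apply: (theta_nabla L_adm mK mL (mS j k ek)) => //.
    by rewrite opp_lfunE (longest_star_coroot w0_longest ek) opprK.
  rewrite [b k]/b (rep_opp pi_rep _ Lw) (piT k _ Lw) kE wactN wact_lin wactZ cs cn.
  rewrite /twist_op (tj_star t_inv w0_longest ek).
  move: (nabla j x) (wact _ x) (tj t j) (tj t j)^-1 => n sx a ai.
  apply/malgP => y; rewrite !(mcoeffD, mcoeffZ, mcoeffN).
  by move: (n@_y) (sx@_y) (x@_y) => *; ring.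
have eigenP j x : gspan L x ->
    tj t j *: wact (simple_refl j) x + (tj t j - (tj t j)^-1) *: nabla j x
      = kappa j *: x <->
    twist_op t (kappa j) j x = (tj t j)^-1 *: x.
  by move=> _; rewrite kE; exact: eigen_anti.
apply: iff_trans (qp_comp_twisted L_adm c_C0 w0_longest quad twistE eigenP f) _.
apply: iff_trans (twisted_systemP t_neq0 t_inv c_dom w0_longest w0_dec w0c_min
  w0_c_stab pi_rep (hecke_opp_reduced rel) mK mL gL) _.
have Lp : gspan L (wact (- w0)%VF (g w0c)) by exact: (gspan_wact mL (gL _ w0c_min)).
have formulaE w : min_reps Phi c w ->
    tw Phi t w0_c *: wact (- w0)%VF
      (pi (\prod_(x <- redex Phi (w0 \o w)%VF) b x) (wact (- w0)%VF (g w0c)))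
    = (tw Phi t w0_c * (-1) ^+ (len Phi w0 + len Phi w)) *: wact (- w0)%VF
      (pi (Tw T (w0 \o w)%VF) (wact (- w0)%VF (g w0c))).
  move=> mw; have ww : weyl Phi w by case: mw.
  (* Each of the l(w0 w) factors - T_x gives a sign. Only the parity of this length matters, and
     parity is additive. *)
  have sgn : (-1) ^+ len Phi (w0 \o w)%VF = (-1) ^+ (len Phi w0 + len Phi w) :> F.
    by rewrite -signr_odd odd_lenM // signr_odd.
  have -> : \prod_(x <- redex Phi (w0 \o w)%VF) b x
      = (-1) ^+ len Phi (w0 \o w)%VF *: Tw T (w0 \o w)%VF.
    exact: hecke_prod_opp.
  by rewrite (rep_scale pi_rep _ _ Lp) wactZ scalerA sgn.
have bE k : pi (b k) (wact (- w0)%VF (g w0c)) = - pi (T k) (wact (- w0)%VF (g w0c)).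
  exact: (rep_opp pi_rep).
split=> -[h1 h2]; split.
- split=> // k kc; have := h1 k kc; rewrite bE => e.
  by rewrite scaleNr -e opprK.
- by move=> w mw; rewrite (gE _ mw) xinv_wact (h2 _ mw); exact: formulaE.
- move=> k kc; have [_ /(_ k kc) e] := h1.
  by rewrite bE e scaleNr opprK.
- by move=> w mw; rewrite -(gE _ mw) (h2 _ mw) xinv_wact; apply/esym; exact: formulaE.
Qed.
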